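(* Let $\varrho_0\equiv1$ and suppose the initial velocity is potential, $(u_0,v_0)=\nabla S_0$, with $$S_0(a,b)=0\ \text{ for } b>-\varepsilon f(a,b),\qquad S_0(a,b)=b+\varepsilon f(a,b)\ \text{ for } b<-\varepsilon f(a,b),$$ where $\varepsilon>0$ is sufficiently small, $f\in C^\infty(\mathbb R^2)$, $f(0,0)=0$, and there exists a neighborhood of the point $(0,0)$ in which $f_{aa}(a,0)\not\equiv0$ and in which the curve determined by the equation $b+\varepsilon f(a,b)=0$ is monotone for every sufficiently small $\varepsilon>0$. Then the shock surface $\mathcal S$ of the pressureless gas system determined by the generalized Rankine–Hugoniot formulas (see context) and the singularity surface $\mathcal F$ determined by the variational (Hopf–Cole) representation (see context) are different surfaces.
   Context: The system is $\varrho_t+(\varrho u)_x+(\varrho v)_y=0$, $(\varrho u)_t+(\varrho u^2)_x+(\varrho uv)_y=0$, $(\varrho v)_t+(\varrho uv)_x+(\varrho v^2)_y=0$ with initial data $(\varrho_0,u_0,v_0)$. Letter subscripts denote derivatives, except that $t$ in $\widetilde P_t,\widetilde I_t,\widetilde J_t$ is a time index. The minus side is $\{b>-\varepsilon f\}$, where the velocity is $(u_-,v_-)=(0,0)$; the plus side is $\{b<-\varepsilon f\}$, where the velocity is $(u_+,v_+)=(\varepsilon f_a,1+\varepsilon f_b)$. The initial discontinuity curve $\mathcal G=\{b+\varepsilon f(a,b)=0\}$ is parametrized by $(A(l),B(l))$, with $l$ increasing in the direction of increasing $a$. Generalized Rankine–Hugoniot surface $\mathcal S$: it is parametrized by $(x^s(t,l),y^s(t,l))$,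 $t>0$ small, with $(x^s,y^s)(0,l)=(A(l),B(l))\in\mathcal G$, where $$x^s_t=\widetilde I_t/\widetilde P_t,\qquad y^s_t=\widetilde J_t/\widetilde P_t,$$ $$\widetilde P_t=\int_0^t[M_+-M_-]d\tau,\quad \widetilde I_t=\int_0^t[u_0^+M_+-u_0^-M_-]d\tau,\quad \widetilde J_t=\int_0^t[v_0^+M_+-v_0^-M_-]d\tau,$$ $M_j=(a_j)_\tau(b_j)_l-(b_j)_\tau(a_j)_l$, $u_0^j=u_j(a_j,b_j)$, $v_0^j=v_j(a_j,b_j)$, and $a_j=a_j(t,l)$, $b_j=b_j(t,l)$ ($j=+,-$) are the initial positions, on the $j$ side of $\mathcal G$, of the characteristics reaching the shock: $x^s=a_j+tu_j(a_j,b_j)$, $y^s=b_j+tv_j(a_j,b_j)$. (These formulas characterize, for $\varrho_0\equiv1$, Radon-measure generalized solutions of the system having a single shock carrying concentrated mass and momentum with densities $\widetilde P_t,\widetilde I_t,\widetilde J_t$ with respect to $dl$.) Variational surface $\mathcal F$: the set of $(t,x,y)$ satisfying $$F(a_+,b_+;t,x,y)-F(a_-,b_-;t,x,y)=0,\qquad F(a,b;t,x,y)=S_0(a,b)+\frac{(x-a)^2}{2t}+\frac{(y-b)^2}{2t},$$ where $(a_j(t,x,y),b_j(t,x,y))$, $j=+,-$, are the solutions on the $j$ side of $\mathcal G$ of $F_a=0$, $F_b=0$. (It is the singular set of $\Psi(t,x,y)=\min_{a,b}F(a,b;t,x,y)$.) *)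

(* Defs.v *)
(* Stdlib reals with Coquelicot *)
From Stdlib Require Import Reals.
From Coquelicot Require Import Coquelicot.
Open Scope R_scope.

(* f is C^infinity on R^2: [ex_diff_n f n] asks for all iterated partial
   derivatives of order at most n, in any order, and for their continuity. *)
Definition smooth2 (f : R -> R -> R) : Prop :=
  forall (n : nat) (a b : R), ex_diff_n f n a b.

Definition on_curve (eps : R) (f : R -> R -> R) (a b : R) : Prop :=
  b + eps * f a b = 0.

Definition minus_side (eps : R) (f : R -> R -> R) (a b : R) : Prop :=
  b > - (eps * f a b).

Definition plus_side (eps : R) (f : R -> R -> R) (a b : R) : Prop :=
  b < - (eps * f a b).

(* On the discontinuity curve both one-sided expressions vanish, so the value 0
   there is the continuous extension. *)
Definition S0 (eps : R) (f : R -> R -> R) (a b : R) : R :=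
  if Rlt_dec b (- (eps * f a b)) then b + eps * f a b else 0.

(* The initial velocity (u0, v0) = grad S0.  It is used only on the two open
   sides of the curve, where S0 is smooth; there it is (0, 0) on the minus side
   and (eps f_a, 1 + eps f_b) on the plus side. *)
Definition u0 (eps : R) (f : R -> R -> R) (a b : R) : R :=
  Derive (fun a' => S0 eps f a' b) a.

Definition v0 (eps : R) (f : R -> R -> R) (a b : R) : R :=
  Derive (fun b' => S0 eps f a b') b.

(* Monotone in the wide sense, as a curve in the (a, b) plane; whether it is
   nondecreasing or nonincreasing may depend on eps. *)
Definition monotone_curve_in (U : R * R -> Prop) (eps : R) (f : R -> R -> R)
  : Prop :=
  (forall a b a' b' : R,
     U (a, b) -> on_curve eps f a b -> U (a', b') -> on_curve eps f a' b' ->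
     a < a' -> b <= b')
  \/
  (forall a b a' b' : R,
     U (a, b) -> on_curve eps f a b -> U (a', b') -> on_curve eps f a' b' ->
     a < a' -> b' <= b).

(* Since U need not be convex, the part of the curve in U may have several
   components; hence the parameter set L is an open set rather than an
   interval. *)
Definition curve_param (U : R * R -> Prop) (eps : R) (f : R -> R -> R)
  (L : R -> Prop) (A B : R -> R) : Prop :=
  open L
  /\ (forall a b : R,
        (U (a, b) /\ on_curve eps f a b) <->
        (exists l : R, L l /\ A l = a /\ B l = b))
  /\ (forall l l' : R, L l -> L l' -> l < l' -> A l < A l')
  /\ (forall l : R, L l -> ex_derive A l /\ ex_derive B l /\ 0 < Derive A l).

(* g(t, l) is C^1 on [0, T) x L, up to and including t = 0: gt and gl are its
   partial derivatives for t > 0, extended continuously to t = 0. *)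
Definition C1_to_zero (T : R) (L : R -> Prop) (g : R -> R -> R) : Prop :=
  exists gt gl : R -> R -> R,
    forall t l : R, 0 <= t < T -> L l ->
      (0 < t -> is_derive (fun s => g s l) t (gt t l))
      /\ is_derive (fun m => g t m) l (gl t l)
      /\ (forall h : R -> R -> R, h = g \/ h = gt \/ h = gl ->
            filterlim (fun z : R * R => h (fst z) (snd z))
              (within (fun z : R * R => 0 <= fst z) (locally (t, l)))
              (locally (h t l))).

(* M = a_t b_l - b_t a_l *)
Definition Mjac (a b : R -> R -> R) (t l : R) : R :=
  Derive (fun s => a s l) t * Derive (fun m => b t m) l
  - Derive (fun s => b s l) t * Derive (fun m => a t m) l.

(* Integrated jump of w(a_j, b_j) M_j across the curve, for the initial density
   identically 1; the weights 1, u0, v0 give the concentrated mass and momenta. *)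
Definition jump_integral (w : R -> R -> R) (ap bp am bm : R -> R -> R)
  (t l : R) : R :=
  RInt (fun s => w (ap s l) (bp s l) * Mjac ap bp s l
                 - w (am s l) (bm s l) * Mjac am bm s l) 0 t.

Definition Pmass (ap bp am bm : R -> R -> R) (t l : R) : R :=
  jump_integral (fun _ _ => 1) ap bp am bm t l.

Definition Imom (eps : R) (f : R -> R -> R) (ap bp am bm : R -> R -> R)
  (t l : R) : R :=
  jump_integral (u0 eps f) ap bp am bm t l.

Definition Jmom (eps : R) (f : R -> R -> R) (ap bp am bm : R -> R -> R)
  (t l : R) : R :=
  jump_integral (v0 eps f) ap bp am bm t l.

(* (a, b)(t, l) is the initial position of the characteristic that reaches
   (x, y)(t, l) at time t. *)
Definition reaches (eps : R) (f : R -> R -> R) (T : R) (L : R -> Prop)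
  (x y a b : R -> R -> R) : Prop :=
  forall t l : R, 0 <= t < T -> L l ->
    x t l = a t l + t * u0 eps f (a t l) (b t l)
    /\ y t l = b t l + t * v0 eps f (a t l) (b t l).

(* The generalized Rankine-Hugoniot conditions for (x, y)(t, l), with
   (ap, bp) and (am, bm) the initial positions on the plus and minus sides. *)
Definition GRH_surface (eps : R) (f : R -> R -> R) (T : R) (L : R -> Prop)
  (A B : R -> R) (x y ap bp am bm : R -> R -> R) : Prop :=
  (forall g : R -> R -> R,
     g = x \/ g = y \/ g = ap \/ g = bp \/ g = am \/ g = bm ->
     C1_to_zero T L g)
  /\ (forall l : R, L l -> x 0 l = A l /\ y 0 l = B l)
  /\ reaches eps f T L x y ap bp
  /\ reaches eps f T L x y am bm
  /\ (forall t l : R, 0 < t < T -> L l ->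
        plus_side eps f (ap t l) (bp t l)
        /\ minus_side eps f (am t l) (bm t l)
        /\ Pmass ap bp am bm t l <> 0
        /\ is_derive (fun s => x s l) t
             (Imom eps f ap bp am bm t l / Pmass ap bp am bm t l)
        /\ is_derive (fun s => y s l) t
             (Jmom eps f ap bp am bm t l / Pmass ap bp am bm t l)).

Definition shock_set (T : R) (L : R -> Prop) (x y : R -> R -> R)
  (t X Y : R) : Prop :=
  0 < t < T /\ exists l : R, L l /\ x t l = X /\ y t l = Y.

Definition Fvar (eps : R) (f : R -> R -> R) (a b t x y : R) : R :=
  S0 eps f a b + (x - a) ^ 2 / (2 * t) + (y - b) ^ 2 / (2 * t).

Definition critical (eps : R) (f : R -> R -> R) (a b t x y : R) : Prop :=
  is_derive (fun a' => Fvar eps f a' b t x y) a 0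
  /\ is_derive (fun b' => Fvar eps f a b' t x y) b 0.

(* The critical points are sought in U: for U bounded, t small and (x, y) near
   the curve inside U there is at most one on each side, which need not be so
   in the whole plane because f is arbitrary at infinity. *)
Definition variational_set (U : R * R -> Prop) (eps : R) (f : R -> R -> R)
  (t x y : R) : Prop :=
  0 < t /\
  exists ap bp am bm : R,
    U (ap, bp) /\ plus_side eps f ap bp /\ critical eps f ap bp t x y
    /\ U (am, bm) /\ minus_side eps f am bm /\ critical eps f am bm t x y
    /\ Fvar eps f ap bp t x y - Fvar eps f am bm t x y = 0.

(* Two subsets of {t > 0} are the same surface if they agree in a neighbourhood
   of each point of the curve {t = 0} x (curve in U) from which they emanate.
   The comparison is local so that it does not see where the two surfaces are
   cut off. *)
Definition same_surface (U : R * R -> Prop) (eps : R) (f : R -> R -> R)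
  (S F : R -> R -> R -> Prop) : Prop :=
  forall a b : R, U (a, b) -> on_curve eps f a b ->
    exists delta : R, 0 < delta /\
      forall t x y : R,
        0 < t < delta -> Rabs (x - a) < delta -> Rabs (y - b) < delta ->
        (S t x y <-> F t x y).

(* Main.v *)
(* Write N = (u, v) for the gradient of phi = b + eps f, which is the plus-side
   velocity, H for its Jacobian, and q(t, l) for the plus foot of the
   characteristic through the shock point X = q + t N(q).  If the two surfaces
   agree, then phi(q) + (t/2) |N(q)|^2 = 0 along the shock; differentiating in
   l and t gives N . X_l = 0 and N . X_t = |N|^2 / 2, so that
   M_- = - det(1 + t H) M_+.  Projecting the momentum balance
   P X_t = (I, J) on N(q(t)) yields
     int_0^t M_+(s) [N(t) . (N(s) - N(t)) + |N(t)|^2 (1 - det(1 + s H)) / 2] ds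
     = 0,
   whose t^2 term is a nonzero multiple of N . H N - |N|^2 tr H, that is, of
   the curvature of the level curve of phi.  For small eps this equals
   - eps f_aa up to O(eps^2), which does not vanish at a point of the curve
   close to (a, 0) with f_aa(a, 0) <> 0. *)
Require Import Defs.
From Stdlib Require Import Reals Lra Psatz List.
From Coquelicot Require Import Coquelicot.
Import ListNotations.
Open Scope R_scope.

(** * Continuity tools and integrals over short times *)

Lemma continuous_Rplus (W : UniformSpace) (g h : W -> R) (z : W) :
  continuous g z -> continuous h z -> continuous (fun w => g w + h w) z.
Proof. exact (continuous_plus (V := R_NormedModule) g h z). Qed.

Lemma continuous_Rmult (W : UniformSpace) (g h : W -> R) (z : W) :
  continuous g z -> continuous h z -> continuous (fun w => g w * h w) z.
Proof. exact (continuous_mult (K := R_AbsRing) g h z). Qed.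

Lemma continuous_Ropp (W : UniformSpace) (g : W -> R) (z : W) :
  continuous g z -> continuous (fun w => - g w) z.
Proof. exact (continuous_opp (V := R_NormedModule) g z). Qed.

Lemma continuous_Rminus (W : UniformSpace) (g h : W -> R) (z : W) :
  continuous g z -> continuous h z -> continuous (fun w => g w - h w) z.
Proof. exact (continuous_minus (V := R_NormedModule) g h z). Qed.

Ltac continuity_arith :=
  lazymatch goal with
  | |- continuous (fun w => @?g w + @?h w) _ =>
      apply (continuous_Rplus _ g h); continuity_arith
  | |- continuous (fun w => @?g w - @?h w) _ =>
      apply (continuous_Rminus _ g h); continuity_arith
  | |- continuous (fun w => @?g w * @?h w) _ =>
      apply (continuous_Rmult _ g h); continuity_arith
  | |- continuous (fun w => - @?g w) _ =>
      apply (continuous_Ropp _ g); continuity_arith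
  | |- continuous (fun w => @?g w / ?c) _ =>
      apply (continuous_Rmult _ g (fun _ => / c)); continuity_arith
  | |- _ => first [apply continuous_const | apply continuous_id | idtac]
  end.

Lemma continuous_near (g : R -> R) (t eta : R) :
  continuous g t -> 0 < eta ->
  exists delta, 0 < delta /\
    forall s, Rabs (s - t) < delta -> Rabs (g s - g t) < eta.
Proof.
intros Hg He.
destruct (proj1 (filterlim_locally g (g t)) Hg (mkposreal _ He)) as [d Hd].
exists d; split; [apply cond_pos|].
intros s Hs; exact (Hd s Hs).
Qed.

Lemma continuous_vanishing (g : R -> R) (tau : R) :
  0 < tau -> continuous g 0 -> (forall s, 0 < s < tau -> g s = 0) -> g 0 = 0.
Proof.
intros Ht Hg Hz.
destruct (Req_dec (g 0) 0) as [|Hn]; [assumption|exfalso].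
destruct (continuous_near g 0 (Rabs (g 0)) Hg (Rabs_pos_lt _ Hn))
  as [d [Hd H]].
assert (0 < Rmin d tau) by (apply Rmin_pos; lra).
assert (Rmin d tau <= d) by apply Rmin_l.
assert (Rmin d tau <= tau) by apply Rmin_r.
specialize (H (Rmin d tau / 2)).
rewrite Rminus_0_r, Rabs_pos_eq in H by lra.
rewrite (Hz (Rmin d tau / 2)) in H by lra.
rewrite Rabs_minus_sym, Rminus_0_r in H; lra.
Qed.

Lemma is_RInt_linear (c1 c2 t : R) :
  is_RInt (fun s => (t - s) * c1 + s * c2) 0 t (t ^ 2 / 2 * (c1 + c2)).
Proof.
evar_last.
- apply (is_RInt_derive
    (fun s => t * s * c1 - s ^ 2 / 2 * c1 + s ^ 2 / 2 * c2)
    (fun s => (t - s) * c1 + s * c2)).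
  + intros s _; auto_derive; [exact I|field].
  + intros s _; continuity_arith.
- unfold minus, plus, opp; simpl; field.
Qed.

(** The linear model integrates to [t ^ 2 / 2 * (c1 + c2)], while the error contributes at most
    [eta * t ^ 2]. With [eta] a quarter of [Rabs (c1 + c2)] a vanishing integral is impossible
    unless the sum is zero. The integrand may depend on the end time [t], as it does after
    projection on a direction taken at [t]. *)
Lemma RInt_zero_first_order (h : R -> R -> R) (tau c1 c2 : R) :
  0 < tau ->
  (forall t, 0 < t < tau -> is_RInt (fun s => h s t) 0 t 0) ->
  (forall eta, 0 < eta -> exists delta, 0 < delta /\
     forall s t, 0 <= s <= t -> 0 < t < delta ->
       Rabs (h s t - ((t - s) * c1 + s * c2)) <= eta * t) ->
  c1 + c2 = 0.
Proof.
intros Ht Hint Happ.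
destruct (Req_dec (c1 + c2) 0) as [|Hn]; [assumption|exfalso].
assert (Hp := Rabs_pos_lt _ Hn).
destruct (Happ (Rabs (c1 + c2) / 4)) as [d [Hd H]]; [lra|].
set (t := Rmin d tau / 2).
assert (0 < Rmin d tau) by (apply Rmin_pos; lra).
assert (Rmin d tau <= d) by apply Rmin_l.
assert (Rmin d tau <= tau) by apply Rmin_r.
assert (Ht0 : 0 < t) by (unfold t; lra).
set (g := fun s => h s t - ((t - s) * c1 + s * c2)).
assert (HI : is_RInt g 0 t (0 - t ^ 2 / 2 * (c1 + c2))).
{ exact (is_RInt_minus _ _ _ _ _ _ (Hint t ltac:(unfold t; lra))
           (is_RInt_linear c1 c2 t)). }
assert (Hb : Rabs (RInt g 0 t) <= (t - 0) * (Rabs (c1 + c2) / 4 * t)).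
{ apply abs_RInt_le_const; [lra|eexists; exact HI|].
  intros s Hs; apply (H s t); unfold t in *; lra. }
replace (RInt g 0 t) with (0 - t ^ 2 / 2 * (c1 + c2)) in Hb
  by (symmetry; apply is_RInt_unique, HI).
rewrite Rminus_0_l, Rabs_Ropp, Rabs_mult, (Rabs_pos_eq (t ^ 2 / 2)) in Hb
  by nra.
assert (0 < t * t * Rabs (c1 + c2)) by (repeat apply Rmult_lt_0_compat; lra).
nra.
Qed.

(** Serves expressions evaluated at several independent small times: the integration time, the end
    time, and two mean value points, one for each velocity component. *)
Lemma continuous_near4 (G : R * R * (R * R) -> R) (eta : R) :
  continuous G ((0, 0), (0, 0)) -> 0 < eta ->
  exists delta, 0 < delta /\ forall a b c d,
    0 <= a < delta -> 0 <= b < delta -> 0 <= c < delta -> 0 <= d < delta ->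
    Rabs (G ((a, b), (c, d)) - G ((0, 0), (0, 0))) <= eta.
Proof.
intros HG He.
destruct (proj1 (filterlim_locally G _) HG (mkposreal _ He)) as [e H].
exists e; split; [apply cond_pos|].
intros a b c d Ha Hb Hc Hd.
apply Rlt_le, (H ((a, b), (c, d))).
assert (forall x, 0 <= x < e -> ball 0 e x) as Hball.
{ intros x Hx; unfold ball; simpl; unfold AbsRing_ball, abs, minus, plus, opp.
  simpl; rewrite Ropp_0, Rplus_0_r, Rabs_pos_eq; lra. }
repeat split; simpl; apply Hball; assumption.
Qed.

(** Derivatives are available at positive times only; continuity lets the interval start at
    [s = 0]. *)
Lemma MVT_from_zero (g dg : R -> R) (tau s t : R) :
  (forall r, r < tau -> continuous g r) ->
  (forall r, 0 < r < tau -> is_derive g r (dg r)) ->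
  0 <= s <= t -> t < tau ->
  exists c, 0 <= c <= t /\ g s - g t = - ((t - s) * dg c).
Proof.
intros Hc Hd Hs Ht.
destruct (MVT_gen g s t dg) as [c [Hc1 Hc2]];
  rewrite ?Rmin_left, ?Rmax_right in * by lra.
- intros r Hr; apply Hd; lra.
- intros r Hr; apply continuity_pt_filterlim, Hc; lra.
- exists c; split; [lra|].
  rewrite <- (Rmult_comm (dg c)), <- Hc2; ring.
Qed.
Ltac continuous_coordinates :=
  match goal with
  | |- continuous (fun z => ?k (?p (?q z))) _ =>
      apply (continuous_comp (fun z => p (q z)) k);
      [apply (continuous_comp q p);
       first [apply continuous_fst | apply continuous_snd]|]
  end.

(** * The momentum balance at a fixed point of the initial curve *)

Lemma is_RInt_zero_combination (g k : R -> R) (t c : R) :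
  0 <= t ->
  (forall s, 0 <= s <= t -> continuous g s) ->
  (forall s, 0 <= s <= t -> continuous k s) ->
  c * RInt g 0 t = RInt k 0 t ->
  is_RInt (fun s => k s - c * g s) 0 t 0.
Proof.
intros Ht Hg Hk H.
assert (Ig : ex_RInt g 0 t).
{ apply (ex_RInt_continuous (V := R_CompleteNormedModule)).
  intros z; rewrite Rmin_left, Rmax_right by lra; apply Hg. }
assert (Ik : ex_RInt k 0 t).
{ apply (ex_RInt_continuous (V := R_CompleteNormedModule)).
  intros z; rewrite Rmin_left, Rmax_right by lra; apply Hk. }
replace 0 with (RInt k 0 t - c * RInt g 0 t) at 2 by lra.
apply (is_RInt_minus (V := R_NormedModule)).
- apply (RInt_correct (V := R_CompleteNormedModule)), Ik.
- apply (is_RInt_scal (V := R_NormedModule)).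
  apply (RInt_correct (V := R_CompleteNormedModule)), Ig.
Qed.

(** With [N = (u, v)] and [x] the planar cross product, |N|^2 (X_t x X_l) = (N . X_t)(N x X_l) - (N
    x X_t)(N . X_l). The last term vanishes because [X_l] is orthogonal to [N]. *)
Lemma half_normal_cross (u v Xt Yt Xl Yl : R) :
  u ^ 2 + v ^ 2 <> 0 ->
  u * Xl + v * Yl = 0 ->
  u * Xt + v * Yt = (u ^ 2 + v ^ 2) / 2 ->
  Xt * Yl - Yt * Xl = (u * Yl - v * Xl) / 2.
Proof.
intros Hn Hl Ht.
apply (Rmult_eq_reg_l (u ^ 2 + v ^ 2)); [|exact Hn].
transitivity ((u * Xt + v * Yt) * (u * Yl - v * Xl)
              - (u * Yt - v * Xt) * (u * Xl + v * Yl)); [ring|].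
rewrite Hl, Ht; field.
Qed.

(** To leading order in [t] the balance reads [Z 0 * (mp 0 - mm 0) = w 0 * mp 0], and the bracket is
    [2 * mp 0]. Used for both components, it says that the shock starts with half the plus-side
    velocity. *)
Lemma average_velocity_at_zero (w mp mm Z : R -> R) (tau : R) :
  0 < tau ->
  (forall g, In g [w; mp; mm; Z] -> forall s, s < tau -> continuous g s) ->
  mm 0 = - mp 0 -> mp 0 <> 0 ->
  (forall t, 0 < t < tau ->
     Z t * RInt (fun s => mp s - mm s) 0 t = RInt (fun s => w s * mp s) 0 t) ->
  Z 0 = w 0 / 2.
Proof.
intros Ht Hc Hm Hn HI.
assert (Cw : forall s, s < tau -> continuous w s) by (apply Hc; simpl; tauto).
assert (Cp : forall s, s < tau -> continuous mp s) by (apply Hc; simpl; tauto).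
assert (Cm : forall s, s < tau -> continuous mm s) by (apply Hc; simpl; tauto).
assert (CZ : forall s, s < tau -> continuous Z s) by (apply Hc; simpl; tauto).
set (c := w 0 * mp 0 - Z 0 * (mp 0 - mm 0)).
assert (Hcc : c + c = 0).
(* The extra factor [t] turns this zeroth-order statement into the first-order one with
   [c1 = c2 = c], since [(t - s) * c + s * c = t * c]. *)
{ apply (RInt_zero_first_order
    (fun s t => t * (w s * mp s - Z t * (mp s - mm s))) tau); [exact Ht| |].
  - intros t Ht'.
    replace 0 with (t * 0) at 2 by ring.
    apply (is_RInt_scal (V := R_NormedModule)
             (fun s => w s * mp s - Z t * (mp s - mm s))).
    apply is_RInt_zero_combination; [lra| | |apply HI, Ht'];
      intros s Hs; continuity_arith;
      first [apply Cw|apply Cp|apply Cm]; lra.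
  - intros eta He.
    set (G := fun z : R * R * (R * R) =>
       w (fst (fst z)) * mp (fst (fst z))
       - Z (snd (fst z)) * (mp (fst (fst z)) - mm (fst (fst z)))).
    assert (CG : continuous G ((0, 0), (0, 0))).
    { unfold G; continuity_arith;
      continuous_coordinates; auto. }
    destruct (continuous_near4 G eta CG He) as [d [Hd HG]].
    exists d; split; [exact Hd|]; intros s t Hs Htd.
    specialize (HG s t 0 0 ltac:(lra) ltac:(lra) ltac:(lra) ltac:(lra)).
    unfold G in HG; simpl in HG; fold c in HG.
    replace (_ - _) with (t * (w s * mp s - Z t * (mp s - mm s) - c)) by ring.
    rewrite Rabs_mult, (Rabs_pos_eq t), Rmult_comm by lra.
    apply Rmult_le_compat_r; lra. }
unfold c in Hcc; rewrite Hm in Hcc.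
apply (Rmult_eq_reg_r (mp 0)); [lra|exact Hn].
Qed.

(* At a fixed [l], as functions of time: (u, v) is the velocity at the plus
   foot, (h11, h12; h21, h22) its Jacobian there, (pt, rt) and (pl, rl) are the
   derivatives of that foot in t and l, and (Xt, Yt), (Xl, Yl) those of the
   shock point, which is also the minus foot. *)
Lemma curvature_from_momentum_balance
  (tau : R) (u v h11 h12 h21 h22 pt rt pl rl Xt Yt Xl Yl : R -> R)
  (mp := fun s => pt s * rl s - rt s * pl s)
  (mm := fun s => Xt s * Yl s - Yt s * Xl s) :
  0 < tau ->
  (forall g,
     In g [u; v; h11; h12; h21; h22; pt; rt; pl; rl; Xt; Yt; Xl; Yl] ->
     forall s, s < tau -> continuous g s) ->
  (forall s, 0 < s < tau ->
     is_derive u s (h11 s * pt s + h12 s * rt s)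
     /\ is_derive v s (h21 s * pt s + h22 s * rt s)
     /\ Xt s = pt s + u s + s * (h11 s * pt s + h12 s * rt s)
     /\ Yt s = rt s + v s + s * (h21 s * pt s + h22 s * rt s)
     /\ Xl s = pl s + s * (h11 s * pl s + h12 s * rl s)
     /\ Yl s = rl s + s * (h21 s * pl s + h22 s * rl s)
     /\ u s * Xt s + v s * Yt s = (u s ^ 2 + v s ^ 2) / 2
     /\ u s * Xl s + v s * Yl s = 0
     /\ Xt s * RInt (fun s => mp s - mm s) 0 s = RInt (fun s => u s * mp s) 0 s
     /\ Yt s * RInt (fun s => mp s - mm s) 0 s = RInt (fun s => v s * mp s) 0 s)
  -> u 0 ^ 2 + v 0 ^ 2 <> 0 -> Xl 0 <> 0 ->
  v 0 ^ 2 * h11 0 - u 0 * v 0 * (h12 0 + h21 0) + u 0 ^ 2 * h22 0 = 0.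
Proof.
intros Ht Hc H HN HX.
assert (HF : List.Forall (fun g => forall s, s < tau -> continuous g s)
  [u; v; h11; h12; h21; h22; pt; rt; pl; rl; Xt; Yt; Xl; Yl])
  by (apply Forall_forall, Hc).
rewrite !Forall_cons_iff in HF.
destruct HF as (Cu & Cv & C11 & C12 & C21 & C22 & Cpt & Crt & Cpl & Crl
                & CXt & CYt & CXl & CYl & _); clear Hc.
assert (Cmp : forall s, s < tau -> continuous mp s)
  by (intros s Hs; unfold mp; continuity_arith; auto).
assert (Cmm : forall s, s < tau -> continuous mm s)
  by (intros s Hs; unfold mm; continuity_arith; auto).
(* The hypotheses concern positive times only; equalities between continuous functions pass to the
   limit at time 0. *)
assert (Hzero : forall g k : R -> R, (forall s, 0 < s < tau -> g s = k s) ->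
          continuous g 0 -> continuous k 0 -> g 0 = k 0).
{ intros g k Hgk Cg Ck; apply Rminus_diag_uniq.
  apply (continuous_vanishing (fun s => g s - k s) tau); [exact Ht| |].
  - apply continuous_Rminus; assumption.
  - intros s Hs; rewrite Hgk by exact Hs; ring. }
assert (EXt := Hzero Xt
  (fun s => pt s + u s + s * (h11 s * pt s + h12 s * rt s))
  ltac:(intros; apply H; assumption) ltac:(auto)
  ltac:(continuity_arith; auto)).
assert (EYt := Hzero Yt
  (fun s => rt s + v s + s * (h21 s * pt s + h22 s * rt s))
  ltac:(intros; apply H; assumption) ltac:(auto)
  ltac:(continuity_arith; auto)).
assert (EXl := Hzero Xl (fun s => pl s + s * (h11 s * pl s + h12 s * rl s))
  ltac:(intros; apply H; assumption) ltac:(auto)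
  ltac:(continuity_arith; auto)).
assert (EYl := Hzero Yl (fun s => rl s + s * (h21 s * pl s + h22 s * rl s))
  ltac:(intros; apply H; assumption) ltac:(auto)
  ltac:(continuity_arith; auto)).
assert (ENt := Hzero (fun s => u s * Xt s + v s * Yt s)
  (fun s => (u s * u s + v s * v s) * / 2)
  ltac:(intros s Hs; cbv beta;
        destruct (H s Hs) as (_ & _ & _ & _ & _ & _ & -> & _); field)
  ltac:(continuity_arith; auto) ltac:(continuity_arith; auto)).
assert (ENl := Hzero (fun s => u s * Xl s + v s * Yl s) (fun s => 0)
  ltac:(intros; apply H; assumption) ltac:(continuity_arith; auto)
  ltac:(continuity_arith; auto)).
cbv beta in EXt, EYt, EXl, EYl, ENt, ENl.
assert (Hm0 : mm 0 = (u 0 * Yl 0 - v 0 * Xl 0) / 2).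
{ apply half_normal_cross; [exact HN|exact ENl|lra]. }
(* At time 0 the foot derivatives are [X_t - N] and [X_l], so [mp 0] is [mm 0] minus N x X_l, which
   equals [2 * mm 0]. *)
assert (Hmp0 : mm 0 = - mp 0).
{ unfold mp; rewrite Hm0.
  assert (E : mm 0 = (u 0 * Yl 0 - v 0 * Xl 0) / 2) by exact Hm0.
  unfold mm in E.
  replace (pt 0) with (Xt 0 - u 0) by (rewrite EXt; ring).
  replace (rt 0) with (Yt 0 - v 0) by (rewrite EYt; ring).
  replace (pl 0) with (Xl 0) by (rewrite EXl; ring).
  replace (rl 0) with (Yl 0) by (rewrite EYl; ring).
  lra. }
(* If [mp 0] were zero, [X_l] would be both orthogonal and parallel to the nonzero vector [N], hence
   zero. *)
assert (Hne : mp 0 <> 0).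
{ intro E; apply HX, (Rmult_eq_reg_l (u 0 ^ 2 + v 0 ^ 2)); [|exact HN].
  replace ((u 0 ^ 2 + v 0 ^ 2) * Xl 0)
    with (u 0 * (u 0 * Xl 0 + v 0 * Yl 0)
          - v 0 * (u 0 * Yl 0 - v 0 * Xl 0)) by ring.
  replace (u 0 * Yl 0 - v 0 * Xl 0) with 0 by lra.
  rewrite ENl; ring. }
assert (EX : Xt 0 = u 0 / 2).
{ apply (average_velocity_at_zero u mp mm Xt tau); try assumption.
  - intros g [<-|[<-|[<-|[<-|[]]]]]; assumption.
  - intros t Htt; apply H; exact Htt. }
assert (EY : Yt 0 = v 0 / 2).
{ apply (average_velocity_at_zero v mp mm Yt tau); try assumption.
  - intros g [<-|[<-|[<-|[<-|[]]]]]; assumption.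
  - intros t Htt; apply H; exact Htt. }
(* Times are shortened to [tau'] so that [N] stays nonzero, as [half_normal_cross] demands at each
   time. *)
destruct (continuous_near (fun s => u s * u s + v s * v s) 0
           (Rabs (u 0 ^ 2 + v 0 ^ 2))) as [d0 [Hd0 Hnear]];
  [continuity_arith; auto|apply Rabs_pos_lt, HN|].
set (tau' := Rmin d0 tau).
assert (Htau' : 0 < tau' /\ tau' <= d0 /\ tau' <= tau).
{ split; [apply Rmin_pos; assumption|split; [apply Rmin_l|apply Rmin_r]]. }
(* [du] and [dv] are the time derivatives of the velocity carried by the plus foot. *)
set (du := fun s => h11 s * pt s + h12 s * rt s).
set (dv := fun s => h21 s * pt s + h22 s * rt s).
set (dd := fun s => h11 s + h22 s + s * (h11 s * h22 s - h12 s * h21 s)).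
assert (Cdu : forall s, s < tau -> continuous du s)
  by (intros s Hs; unfold du; continuity_arith; auto).
assert (Cdv : forall s, s < tau -> continuous dv s)
  by (intros s Hs; unfold dv; continuity_arith; auto).
assert (Cdd : forall s, s < tau -> continuous dd s)
  by (intros s Hs; unfold dd; continuity_arith; auto).
(* [1 + s dd] is the Jacobian determinant of the flow map [q + s N(q)]. *)
assert (Hmm : forall s, 0 <= s < tau' -> mm s = - (1 + s * dd s) * mp s).
{ intros s Hs; destruct (Req_dec s 0) as [->|Hs0]; [rewrite Hmp0; ring|].
  destruct (H s ltac:(lra)) as (_ & _ & E1 & E2 & E3 & E4 & E5 & E6 & _).
  assert (Hns : u s ^ 2 + v s ^ 2 <> 0).
  { intro E; specialize (Hnear s); cbv beta in Hnear.
    rewrite Rminus_0_r, Rabs_pos_eq in Hnear by lra.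
    specialize (Hnear ltac:(lra)).
    replace (_ - _) with (- (u 0 ^ 2 + v 0 ^ 2)) in Hnear by nra.
    rewrite Rabs_Ropp in Hnear; lra. }
  assert (E : mm s = (u s * Yl s - v s * Xl s) / 2).
  { apply half_normal_cross; assumption. }
  (* [X_t - N] and [X_l] are the images of the two foot derivatives under [1 + s H], so their cross
     product is the determinant times [mp]. *)
  assert (E' : (1 + s * dd s) * mp s
               = (Xt s - u s) * Yl s - (Yt s - v s) * Xl s).
  { rewrite E1, E2, E3, E4; unfold dd, mp; ring. }
  unfold mm in E |- *; lra. }
(* [c1] is the coefficient coming from N(t) . (N(s) - N(t)), which is about -(t - s) N . N', and
   [c2] the one coming from |N|^2 (1 - det(1 + s H)) / 2, which is -s |N|^2 [dd] / 2. *)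
set (c1 := - (mp 0 * (u 0 * du 0 + v 0 * dv 0))).
set (c2 := - (mp 0 * ((u 0 * u 0 + v 0 * v 0) / 2 * dd 0))).
assert (Hcc : c1 + c2 = 0).
{ apply (RInt_zero_first_order
    (fun s t => (u t * u s + v t * v s) * mp s
                - (u t * u t + v t * v t) / 2 * (mp s - mm s)) tau');
    [lra| |].
  - intros t Htt.
    apply (is_RInt_zero_combination (fun s => mp s - mm s)
             (fun s => (u t * u s + v t * v s) * mp s)); [lra| | |].
    + intros s Hs; apply continuous_Rminus; [apply Cmp|apply Cmm]; lra.
    + intros s Hs; continuity_arith;
        first [apply Cmp|apply Cu|apply Cv]; lra.
    (* The two momentum balances are combined with the weights [u t] and [v t], constant in the
       integration variable; the mass then carries the factor N . X_t = |N|^2 / 2. *)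
    + destruct (H t ltac:(lra)) as (_ & _ & _ & _ & _ & _ & E & _ & I & J).
      replace (_ / 2) with (u t * Xt t + v t * Yt t) by (rewrite E; field).
      rewrite Rmult_plus_distr_r, !Rmult_assoc, I, J.
      symmetry; apply is_RInt_unique.
      apply (is_RInt_ext
        (fun s => plus (scal (u t) (u s * mp s)) (scal (v t) (v s * mp s)))).
      { intros s _; unfold plus, scal; simpl; unfold mult; simpl; ring. }
      apply (is_RInt_plus (V := R_NormedModule));
        apply (is_RInt_scal (V := R_NormedModule));
        apply (RInt_correct (V := R_CompleteNormedModule));
        apply (ex_RInt_continuous (V := R_CompleteNormedModule));
        intros z; rewrite Rmin_left, Rmax_right by lra; intros Hz;
        continuity_arith; first [apply Cmp|apply Cu|apply Cv]; lra.
  - intros eta He.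
    set (G1 := fun z : R * R * (R * R) => - (mp (fst (fst z)) *
       (u (snd (fst z)) * du (fst (snd z))
        + v (snd (fst z)) * dv (snd (snd z))))).
    set (G2 := fun z : R * R * (R * R) => - (mp (fst (fst z)) *
       ((u (snd (fst z)) * u (snd (fst z))
         + v (snd (fst z)) * v (snd (fst z))) / 2 * dd (fst (fst z))))).
    assert (CG1 : continuous G1 ((0, 0), (0, 0))).
    { unfold G1; continuity_arith; continuous_coordinates; auto. }
    assert (CG2 : continuous G2 ((0, 0), (0, 0))).
    { unfold G2; continuity_arith; continuous_coordinates; auto. }
    destruct (continuous_near4 G1 eta CG1 He) as [d1 [Hd1 HG1]].
    destruct (continuous_near4 G2 eta CG2 He) as [d2 [Hd2 HG2]].
    set (d := Rmin tau' (Rmin d1 d2)).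
    assert (Hd : 0 < d /\ d <= tau' /\ d <= d1 /\ d <= d2).
    { unfold d; repeat split.
      - repeat apply Rmin_pos; lra.
      - apply Rmin_l.
      - eapply Rle_trans; [apply Rmin_r|apply Rmin_l].
      - eapply Rle_trans; [apply Rmin_r|apply Rmin_r]. }
    exists d; split; [lra|]; intros s t Hs Htd.
    (* The increments of [u] and [v] are replaced exactly by derivatives at [x1] and [x2], so the
       error splits into [(t - s) * (g1 - c1) + s * (g2 - c2)], with both brackets at most [eta] in
       absolute value. *)
    destruct (MVT_from_zero u du tau s t Cu
      ltac:(intros r Hr; apply H, Hr) Hs ltac:(lra)) as [x1 [Hx1 U1]].
    destruct (MVT_from_zero v dv tau s t Cv
      ltac:(intros r Hr; apply H, Hr) Hs ltac:(lra)) as [x2 [Hx2 V1]].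
    specialize (HG1 s t x1 x2 ltac:(lra) ltac:(lra) ltac:(lra) ltac:(lra)).
    specialize (HG2 s t x1 x2 ltac:(lra) ltac:(lra) ltac:(lra) ltac:(lra)).
    unfold G1 in HG1; unfold G2 in HG2; simpl in HG1, HG2.
    fold c1 in HG1; fold c2 in HG2.
    rewrite (Hmm s) by lra.
    set (g1 := - (mp s * (u t * du x1 + v t * dv x2))) in HG1.
    set (g2 := - (mp s * ((u t * u t + v t * v t) / 2 * dd s))) in HG2.
    replace (_ - _) with ((t - s) * (g1 - c1) + s * (g2 - c2)).
    2:{ unfold g1, g2.
        replace (u s) with (u t - (t - s) * du x1) by lra.
        replace (v s) with (v t - (t - s) * dv x2) by lra.
        field. }
    eapply Rle_trans; [apply Rabs_triang|].
    rewrite !Rabs_mult, (Rabs_pos_eq s), (Rabs_pos_eq (t - s)) by lra.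
    nra. }
(* At time 0 the foot recedes with velocity [X_t - N = - N / 2]. Hence [c1 + c2] is [mp 0 / 2] times
   N . H N - |N|^2 tr H, the negative of the claimed expression. *)
assert (Ept : pt 0 = - (u 0) / 2) by lra.
assert (Ert : rt 0 = - (v 0) / 2) by lra.
unfold c1, c2, du, dv, dd in Hcc; rewrite Ept, Ert in Hcc.
apply (Rmult_eq_reg_l (mp 0)); [|exact Hne].
lra.
Qed.

(** * Calculus of two variables and injectivity of the plus-side flow *)

(** The partial derivatives are explicit arguments, so that the entries of the Jacobian of the
    velocity can be named and handed on to the curvature identity. *)
Definition C1_partials (g gx gy : R -> R -> R) : Prop :=
  forall a b : R,
    is_derive (fun z => g z b) a (gx a b)
    /\ is_derive (fun z => g a z) b (gy a b)
    /\ forall h, In h [g; gx; gy] ->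
         continuous (fun z : R * R => h (fst z) (snd z)) (a, b).

Lemma C1_partials_continuous (g gx gy h : R -> R -> R) (z : R * R) :
  C1_partials g gx gy -> In h [g; gx; gy] ->
  continuous (fun z : R * R => h (fst z) (snd z)) z.
Proof. destruct z; intros H; apply H. Qed.

Lemma smooth2_partials (f : R -> R -> R) :
  smooth2 f ->
  C1_partials f (fun a b => Derive (fun z => f z b) a)
    (fun a b => Derive (fun z => f a z) b)
  /\ smooth2 (fun a b => Derive (fun z => f z b) a)
  /\ smooth2 (fun a b => Derive (fun z => f a z) b).
Proof.
intros H; split; [|split].
- intros a b.
  destruct (H 1%nat a b) as (H0 & H1 & H2 & [H3 _] & [H4 _]).
  split; [|split].
  + apply Derive_correct, H1.
  + apply Derive_correct, H2.
  + intros h Hh; apply (proj1 (continuity_2d_pt_filterlim h a b)).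
    destruct Hh as [<-|[<-|[<-|[]]]]; assumption.
- intros n a b; apply (H (S n) a b).
- intros n a b; apply (H (S n) a b).
Qed.

(** One form covers the function [b + eps * f a b] and the two velocity components [eps * fa] and
    [1 + eps * fb]. *)
Lemma C1_partials_affine (g gx gy : R -> R -> R) (c d k : R) :
  C1_partials g gx gy ->
  C1_partials (fun a b => c + d * b + k * g a b)
    (fun a b => k * gx a b) (fun a b => d + k * gy a b).
Proof.
intros H a b; destruct (H a b) as (Hx & Hy & Hc); split; [|split].
- assert (E : Derive (fun z : R => g z b) a = gx a b)
    by exact (is_derive_unique _ _ _ Hx).
  auto_derive; [exists (gx a b); exact Hx|rewrite E; ring].
- assert (E : Derive (fun z : R => g a z) b = gy a b)
    by exact (is_derive_unique _ _ _ Hy).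
  auto_derive; [exists (gy a b); exact Hy|rewrite E; ring].
- intros h [<-|[<-|[<-|[]]]]; continuity_arith;
    solve [apply continuous_snd | apply Hc; simpl; tauto].
Qed.

Lemma C1_partials_chain (g gx gy : R -> R -> R) (p r : R -> R) (s p' r' : R) :
  C1_partials g gx gy -> is_derive p s p' -> is_derive r s r' ->
  is_derive (fun t => g (p t) (r t)) s
    (gx (p s) (r s) * p' + gy (p s) (r s) * r').
Proof.
intros H Hp Hr.
apply is_derive_Reals, derivable_pt_lim_comp_2d;
  try (apply is_derive_Reals; assumption).
apply filterdiff_differentiable_pt_lim.
eapply filterdiff_ext_lin.
- apply (is_derive_filterdiff g (p s) (r s) gx (gy (p s) (r s))).
  + exists (mkposreal 1 Rlt_0_1); intros y _; apply H.
  + apply H.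
  + apply (C1_partials_continuous g gx gy); [exact H|simpl; tauto].
- reflexivity.
Qed.

Lemma continuous_C1_partials_comp (W : UniformSpace) (g gx gy h : R -> R -> R)
  (p r : W -> R) (z : W) :
  C1_partials g gx gy -> In h [g; gx; gy] ->
  continuous p z -> continuous r z -> continuous (fun w => h (p w) (r w)) z.
Proof.
intros H Hh Hp Hr; apply continuous_comp_2; [exact Hp|exact Hr|].
apply (C1_partials_continuous g gx gy); assumption.
Qed.

(** Uniform continuity gives a scale [d] over which [h] varies by less than 1. Points with both
    coordinates below [(n + 1) * d] in absolute value are reached from the origin by [n + 1] radial
    steps of that scale. *)
Lemma bounded_on_square (h : R -> R -> R) (K : R) :
  0 <= K ->
  (forall z, continuous (fun z : R * R => h (fst z) (snd z)) z) ->
  exists M, 0 < M /\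
    forall a b, Rabs a <= K -> Rabs b <= K -> Rabs (h a b) <= M.
Proof.
intros HK Hh.
destruct (uniform_continuity_2d h (- K) K (- K) K
            (fun a b _ _ => proj2 (continuity_2d_pt_filterlim h a b) (Hh (a, b)))
            (mkposreal 1 Rlt_0_1)) as [d Hd].
assert (Hd0 := cond_pos d).
assert (Hind : forall n a b, Rabs a <= K -> Rabs b <= K ->
  Rabs a < (INR n + 1) * d -> Rabs b < (INR n + 1) * d ->
  Rabs (h a b) <= Rabs (h 0 0) + (INR n + 1)).
{ induction n as [|n IH]; intros a b Ha Hb Ha' Hb'.
  - simpl in *.
    assert (Hs := Hd 0 0 a b ltac:(lra) ltac:(lra)
                    (proj1 (Rabs_le_between _ _) Ha)
                    (proj1 (Rabs_le_between _ _) Hb)).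
    rewrite !Rminus_0_r in Hs; specialize (Hs ltac:(lra) ltac:(lra)).
    assert (Htri := Rabs_triang_inv (h a b) (h 0 0)); lra.
  (* Scaling by [k] brings the radius [(n + 2) * d] down to [(n + 1) * d] and moves each coordinate
     by less than [d]. *)
  - set (k := (INR n + 1) / (INR n + 2)).
    rewrite S_INR in *.
    assert (Hn := pos_INR n).
    assert (Hk : 0 < k < 1 /\ k * (INR n + 2) = INR n + 1).
    { unfold k; split; [|field; lra].
      split; [apply Rdiv_lt_0_compat; lra|].
      apply Rlt_div_l; lra. }
    assert (Hscale : forall c, Rabs c <= K -> Rabs c < (INR n + 1 + 1) * d ->
      Rabs (k * c) <= K /\ Rabs (k * c) < (INR n + 1) * d
      /\ Rabs (c - k * c) < d).
    { intros c Hc Hc'.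
      assert (Hp := Rabs_pos c).
      rewrite Rabs_mult, (Rabs_pos_eq k) by lra.
      replace (c - k * c) with ((1 - k) * c) by ring.
      rewrite Rabs_mult, (Rabs_pos_eq (1 - k)) by lra.
      destruct Hk as [Hk1 Hk2]; rewrite <- Hk2.
      assert (Hk3 : (1 - k) * (INR n + 2) = 1) by lra.
      repeat split; [nra| |].
      - rewrite Rmult_assoc; apply Rmult_lt_compat_l; lra.
      - replace (pos d) with ((1 - k) * ((INR n + 1 + 1) * d)).
        + apply Rmult_lt_compat_l; lra.
        + replace (INR n + 1 + 1) with (INR n + 2) by ring.
          rewrite <- Rmult_assoc, Hk3; ring. }
    destruct (Hscale a Ha Ha') as (A1 & A2 & A3).
    destruct (Hscale b Hb Hb') as (B1 & B2 & B3).
    assert (Hprev := IH (k * a) (k * b) A1 B1 A2 B2).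
    assert (Hs := Hd (k * a) (k * b) a b
      (proj1 (Rabs_le_between _ _) A1) (proj1 (Rabs_le_between _ _) B1)
      (proj1 (Rabs_le_between _ _) Ha) (proj1 (Rabs_le_between _ _) Hb) A3 B3).
    simpl in Hs.
    assert (Htri := Rabs_triang_inv (h a b) (h (k * a) (k * b))); lra. }
destruct (archimed_cor1 (d / (K + 1))) as [n [Hn1 Hn2]].
{ apply Rdiv_lt_0_compat; lra. }
assert (Hn : 0 < INR n) by (apply lt_0_INR, Hn2).
assert (HKn : K < INR n * d).
{ apply (Rmult_lt_compat_r (INR n)) in Hn1; [|exact Hn].
  rewrite Rinv_l in Hn1 by lra.
  apply (Rmult_lt_compat_r (K + 1)) in Hn1; [|lra].
  replace (d / (K + 1) * INR n * (K + 1)) with (INR n * d) in Hn1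
    by (field; lra).
  lra. }
exists (Rabs (h 0 0) + (INR n + 1)).
assert (H0 := Rabs_pos (h 0 0)); split; [lra|].
intros a b Ha Hb; apply Hind; nra.
Qed.

(** Apply the mean value theorem along one horizontal and one vertical segment. Both stay in the
    square, where the partial derivatives are bounded by [M1] and [M2]. *)
Lemma C1_partials_lipschitz (g gx gy : R -> R -> R) (K : R) :
  0 <= K -> C1_partials g gx gy ->
  exists M, 0 < M /\ forall a b a' b',
    Rabs a <= K -> Rabs b <= K -> Rabs a' <= K -> Rabs b' <= K ->
    Rabs (g a b - g a' b') <= M * (Rabs (a - a') + Rabs (b - b')).
Proof.
intros HK H.
destruct (bounded_on_square gx K HK) as [M1 [HM1 B1]].
{ intros z; apply (C1_partials_continuous g gx gy); [exact H|simpl; tauto]. }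
destruct (bounded_on_square gy K HK) as [M2 [HM2 B2]].
{ intros z; apply (C1_partials_continuous g gx gy); [exact H|simpl; tauto]. }
exists (M1 + M2); split; [lra|].
intros a b a' b' Ha Hb Ha' Hb'.
assert (Hbetween : forall c d e, Rabs c <= K -> Rabs d <= K ->
          Rmin c d <= e <= Rmax c d -> Rabs e <= K).
{ intros c d e Hc Hd He; apply Rabs_le_between.
  apply Rabs_le_between in Hc; apply Rabs_le_between in Hd.
  assert (- K <= Rmin c d) by (apply Rmin_glb; lra).
  assert (Rmax c d <= K) by (apply Rmax_lub; lra).
  lra. }
destruct (MVT_gen (fun z => g z b) a' a (fun z => gx z b)) as [c [Hc E1]].
{ intros z _; apply H. }
{ intros z _; apply continuity_pt_filterlim.
  apply (ex_derive_continuous (fun z => g z b)); exists (gx z b); apply H. }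
destruct (MVT_gen (fun z => g a' z) b' b (fun z => gy a' z)) as [e [He E2]].
{ intros z _; apply H. }
{ intros z _; apply continuity_pt_filterlim.
  apply (ex_derive_continuous (fun z => g a' z)); exists (gy a' z); apply H. }
replace (g a b - g a' b') with (gx c b * (a - a') + gy a' e * (b - b'))
  by (rewrite <- E1, <- E2; ring).
eapply Rle_trans; [apply Rabs_triang|]; rewrite !Rabs_mult.
assert (Rabs (gx c b) <= M1) by (apply B1; eauto).
assert (Rabs (gy a' e) <= M2) by (apply B2; eauto).
assert (P1 := Rabs_pos (a - a')); assert (P2 := Rabs_pos (b - b')).
nra.
Qed.

(** Equal images bound each coordinate difference by [t * M * D], with [D] their sum in absolute
    value. Then [D <= 2 * t * M * D <= D / 2], which forces [D = 0]. *)
Lemma flow_injective (gu gv : R -> R -> R) (M t a b a' b' : R) :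
  0 < M -> 0 < t -> t * (4 * M) < 1 ->
  Rabs (gu a b - gu a' b') <= M * (Rabs (a - a') + Rabs (b - b')) ->
  Rabs (gv a b - gv a' b') <= M * (Rabs (a - a') + Rabs (b - b')) ->
  a + t * gu a b = a' + t * gu a' b' ->
  b + t * gv a b = b' + t * gv a' b' ->
  a = a' /\ b = b'.
Proof.
intros HM Ht HtM Hu Hv Ea Eb.
set (D := Rabs (a - a') + Rabs (b - b')) in *.
assert (P1 := Rabs_pos (a - a')); assert (P2 := Rabs_pos (b - b')).
assert (Ha : Rabs (a - a') <= t * (M * D)).
{ replace (a - a') with (t * - (gu a b - gu a' b')) by lra.
  rewrite Rabs_mult, Rabs_Ropp, (Rabs_pos_eq t) by lra.
  apply Rmult_le_compat_l; lra. }
assert (Hb : Rabs (b - b') <= t * (M * D)).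
{ replace (b - b') with (t * - (gv a b - gv a' b')) by lra.
  rewrite Rabs_mult, Rabs_Ropp, (Rabs_pos_eq t) by lra.
  apply Rmult_le_compat_l; lra. }
assert (HD : D = 0) by (unfold D in *; nra).
split; apply Rminus_diag_uniq; apply Rabs_eq_0; unfold D in HD; lra.
Qed.

(** * The gradient of [S0] and the variational set *)

Ltac equation_in_R :=
  match goal with |- ?p = ?q => change (@eq R p q) end.

Lemma locally_pos (g : R -> R) (z : R) :
  continuous g z -> 0 < g z -> locally z (fun y => 0 < g y).
Proof.
intros Hg Hp; apply (Hg (fun y => 0 < y)), open_gt, Hp.
Qed.

(** The side is open, so along each axis [S0] coincides near the point with the smooth expression
    [b + eps * f a b]. *)
Lemma S0_derive_plus (eps : R) (f fa fb : R -> R -> R) (a b : R) :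
  C1_partials f fa fb -> plus_side eps f a b ->
  is_derive (fun z => S0 eps f z b) a (eps * fa a b)
  /\ is_derive (fun z => S0 eps f a z) b (1 + eps * fb a b).
Proof.
intros H Hp; unfold plus_side in Hp.
destruct (C1_partials_affine f fa fb 0 1 eps H a b) as (Ha & Hb & _).
assert (Hx := ex_derive_continuous _ _ (ex_intro _ _ Ha)).
assert (Hy := ex_derive_continuous _ _ (ex_intro _ _ Hb)).
split.
- apply (is_derive_ext_loc (fun z => 0 + 1 * b + eps * f z b)); [|exact Ha].
  generalize (locally_pos _ _ (continuous_Ropp _ _ _ Hx) ltac:(cbv beta; lra)).
  apply filter_imp; intros z Hz; unfold S0.
  destruct (Rlt_dec b (- (eps * f z b))); lra.
- apply (is_derive_ext_loc (fun z => 0 + 1 * z + eps * f a z)); [|exact Hb].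
  generalize (locally_pos _ _ (continuous_Ropp _ _ _ Hy) ltac:(cbv beta; lra)).
  apply filter_imp; intros z Hz; unfold S0.
  destruct (Rlt_dec z (- (eps * f a z))); lra.
Qed.

Lemma S0_derive_minus (eps : R) (f fa fb : R -> R -> R) (a b : R) :
  C1_partials f fa fb -> minus_side eps f a b ->
  is_derive (fun z => S0 eps f z b) a 0
  /\ is_derive (fun z => S0 eps f a z) b 0.
Proof.
intros H Hp; unfold minus_side in Hp.
destruct (C1_partials_affine f fa fb 0 1 eps H a b) as (Ha & Hb & _).
assert (Hx := ex_derive_continuous _ _ (ex_intro _ _ Ha)).
assert (Hy := ex_derive_continuous _ _ (ex_intro _ _ Hb)).
split.
- apply (is_derive_ext_loc (fun _ => 0)); [|apply (is_derive_const 0)].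
  generalize (locally_pos _ _ Hx ltac:(cbv beta; lra)).
  apply filter_imp; intros z Hz; unfold S0.
  destruct (Rlt_dec b (- (eps * f z b))); lra.
- apply (is_derive_ext_loc (fun _ => 0)); [|apply (is_derive_const 0)].
  generalize (locally_pos _ _ Hy ltac:(cbv beta; lra)).
  apply filter_imp; intros z Hz; unfold S0.
  destruct (Rlt_dec z (- (eps * f a z))); lra.
Qed.

(** Stationarity balances the gradient of [S0] against [(x - a) / t] and [(y - b) / t]: critical
    points are feet of characteristics. *)
Lemma critical_foot (eps : R) (f : R -> R -> R) (a b t x y ga gb : R) :
  t <> 0 ->
  is_derive (fun z => S0 eps f z b) a ga ->
  is_derive (fun z => S0 eps f a z) b gb ->
  critical eps f a b t x y -> x = a + t * ga /\ y = b + t * gb.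
Proof.
intros Ht Ha Hb [Ca Cb].
assert (Hq : forall c k z, is_derive (fun w => (c - w) ^ 2 / (2 * t) + k) z
                             (- ((c - z) / t))).
{ intros c k z; auto_derive; [exact I|field; exact Ht]. }
assert (Ea : ga + - ((x - a) / t) = 0).
{ rewrite <- (is_derive_unique _ _ _ Ca); symmetry; apply is_derive_unique.
  apply (is_derive_ext
    (fun z => S0 eps f z b + ((x - z) ^ 2 / (2 * t) + (y - b) ^ 2 / (2 * t)))).
  { intros z; unfold Fvar; equation_in_R; ring. }
  apply (is_derive_plus (V := R_NormedModule)); [exact Ha|apply Hq]. }
assert (Eb : gb + - ((y - b) / t) = 0).
{ rewrite <- (is_derive_unique _ _ _ Cb); symmetry; apply is_derive_unique.
  apply (is_derive_ext
    (fun z => S0 eps f a z + ((y - z) ^ 2 / (2 * t) + (x - a) ^ 2 / (2 * t)))).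
  { intros z; unfold Fvar; equation_in_R; ring. }
  apply (is_derive_plus (V := R_NormedModule)); [exact Hb|apply Hq]. }
split; [replace ga with ((x - a) / t) by lra|replace gb with ((y - b) / t) by lra];
  field; exact Ht.
Qed.

(** The minus critical point is [(x, y)] itself, where [Fvar] is zero. From the plus foot the
    displacement is [t N], so the quadratic terms of [Fvar] add up to t |N|^2 / 2. *)
Lemma variational_set_eikonal (U : R * R -> Prop) (eps : R)
  (f fa fb : R -> R -> R) (t x y : R) :
  C1_partials f fa fb -> variational_set U eps f t x y ->
  exists a b, U (a, b)
    /\ x = a + t * (eps * fa a b) /\ y = b + t * (1 + eps * fb a b)
    /\ b + eps * f a b
       + t / 2 * ((eps * fa a b) ^ 2 + (1 + eps * fb a b) ^ 2) = 0.
Proof.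
intros H (Ht & a & b & a' & b' & HU & Hp & Cp & _ & Hm & Cm & HF).
destruct (S0_derive_plus eps f fa fb a b H Hp) as [Da Db].
destruct (S0_derive_minus eps f fa fb a' b' H Hm) as [Da' Db'].
destruct (critical_foot eps f a b t x y _ _ ltac:(lra) Da Db Cp) as [Ex Ey].
destruct (critical_foot eps f a' b' t x y _ _ ltac:(lra) Da' Db' Cm)
  as [Ex' Ey'].
exists a, b; split; [exact HU|split; [exact Ex|split; [exact Ey|]]].
unfold Fvar, S0 in HF; unfold plus_side in Hp; unfold minus_side in Hm.
destruct (Rlt_dec b (- (eps * f a b))); [|lra].
destruct (Rlt_dec b' (- (eps * f a' b'))); [lra|].
replace (x - a') with 0 in HF by lra; replace (y - b') with 0 in HF by lra.
replace (x - a) with (t * (eps * fa a b)) in HF by lra.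
replace (y - b) with (t * (1 + eps * fb a b)) in HF by lra.
rewrite <- HF; field; lra.
Qed.

(** * Feet of characteristics on the Rankine-Hugoniot surface *)

Lemma C1_to_zero_near (T : R) (L : R -> Prop) (g : R -> R -> R) (l eta : R) :
  0 < T -> L l -> C1_to_zero T L g -> 0 < eta ->
  exists delta, 0 < delta /\ forall t m,
    0 <= t < delta -> Rabs (m - l) < delta -> Rabs (g t m - g 0 l) < eta.
Proof.
intros HT HL (gt & gl & H) He.
destruct (H 0 l ltac:(lra) HL) as (_ & _ & Hc).
destruct (proj1 (filterlim_locally _ _) (Hc g (or_introl eq_refl))
            (mkposreal _ He)) as [d Hd].
exists d; split; [apply cond_pos|].
intros t m Ht Hm; apply (Hd (t, m)); [|simpl; lra].
split; [|exact Hm].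
simpl; unfold ball; simpl; unfold AbsRing_ball, abs, minus, plus, opp; simpl.
rewrite Ropp_0, Rplus_0_r, Rabs_pos_eq; lra.
Qed.

(* Freezing time at [0] for negative times turns one-sided continuity at [0]
   into continuity. *)
Lemma continuous_extend_before_zero (T : R) (h : R -> R -> R) (l : R) :
  0 < T ->
  (forall t, 0 <= t < T ->
     filterlim (fun z : R * R => h (fst z) (snd z))
       (within (fun z : R * R => 0 <= fst z) (locally (t, l)))
       (locally (h t l))) ->
  forall s, s < T -> continuous (fun s => h (Rmax 0 s) l) s.
Proof.
intros HT H s Hs.
assert (Hmax : 0 <= Rmax 0 s < T).
{ split; [apply Rmax_l|apply Rmax_lub_lt; lra]. }
refine (filterlim_comp _ _ _ (fun s => (Rmax 0 s, l))
          (fun z => h (fst z) (snd z)) _ _ _ _ (H _ Hmax)).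
intros P [e He]; exists e; intros r Hr.
apply He; [|simpl; apply Rmax_l].
split; [|apply ball_center].
unfold ball in Hr |- *; simpl in Hr |- *.
unfold AbsRing_ball, abs, minus, plus, opp in Hr |- *; simpl in Hr |- *.
revert Hr; unfold Rmax; destruct (Rle_dec 0 r), (Rle_dec 0 s);
  intros Hr; unfold Rabs in *; repeat destruct Rcase_abs; lra.
Qed.

Lemma minus_foot_is_shock (eps : R) (f fa fb : R -> R -> R) (T : R)
  (L : R -> Prop) (A B : R -> R) (x y ap bp am bm : R -> R -> R) :
  C1_partials f fa fb ->
  GRH_surface eps f T L A B x y ap bp am bm ->
  forall t l, 0 <= t < T -> L l -> x t l = am t l /\ y t l = bm t l.
Proof.
intros Hf (_ & _ & _ & Hm & H) t l Ht Hl.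
destruct (Hm t l Ht Hl) as [-> ->].
(* At time 0 the foot lies on the discontinuity curve, where [u0] and [v0] may be default values of
   [Derive]; the factor [t] removes them. *)
destruct (Req_dec t 0) as [->|Ht0]; [split; ring|].
destruct (H t l ltac:(lra) Hl) as (_ & Hs & _).
destruct (S0_derive_minus eps f fa fb _ _ Hf Hs) as [Ha Hb].
unfold u0, v0.
replace (Derive (fun z => S0 eps f z (bm t l)) (am t l)) with 0
  by (symmetry; apply is_derive_unique, Ha).
replace (Derive (fun z => S0 eps f (am t l) z) (bm t l)) with 0
  by (symmetry; apply is_derive_unique, Hb).
split; ring.
Qed.

Lemma plus_foot_flow (eps : R) (f fa fb : R -> R -> R) (T : R)
  (L : R -> Prop) (A B : R -> R) (x y ap bp am bm : R -> R -> R) :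
  C1_partials f fa fb ->
  GRH_surface eps f T L A B x y ap bp am bm ->
  forall t l, 0 < t < T -> L l ->
    u0 eps f (ap t l) (bp t l) = eps * fa (ap t l) (bp t l)
    /\ v0 eps f (ap t l) (bp t l) = 1 + eps * fb (ap t l) (bp t l)
    /\ x t l = ap t l + t * (eps * fa (ap t l) (bp t l))
    /\ y t l = bp t l + t * (1 + eps * fb (ap t l) (bp t l)).
Proof.
intros Hf (_ & _ & Hp & _ & H) t l Ht Hl.
destruct (Hp t l ltac:(lra) Hl) as [Ex Ey].
destruct (H t l Ht Hl) as (Hs & _).
destruct (S0_derive_plus eps f fa fb _ _ Hf Hs) as [Ha Hb].
assert (Eu : u0 eps f (ap t l) (bp t l) = eps * fa (ap t l) (bp t l))
  by exact (is_derive_unique _ _ _ Ha).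
assert (Ev : v0 eps f (ap t l) (bp t l) = 1 + eps * fb (ap t l) (bp t l))
  by exact (is_derive_unique _ _ _ Hb).
rewrite Eu in Ex; rewrite Ev in Ey; auto.
Qed.

(** * Consequences of the coincidence of the two surfaces *)

(** A shock point in the variational set has a plus foot in [U] satisfying the eikonal relation, a
    priori different from [(ap, bp)]. Both feet lie in the square of half-width [K], where the flow
    is injective at short times, so they agree. *)
Lemma same_surface_eikonal (eps K T : R) (U : R * R -> Prop)
  (f fa fb gu gux guy gv gvx gvy : R -> R -> R) (L : R -> Prop) (A B : R -> R)
  (x y ap bp am bm : R -> R -> R) (l : R) :
  C1_partials f fa fb -> C1_partials gu gux guy -> C1_partials gv gvx gvy ->
  (forall a b, gu a b = eps * fa a b) ->
  (forall a b, gv a b = 1 + eps * fb a b) ->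
  open U -> (forall a b, U (a, b) -> Rabs a <= K /\ Rabs b <= K) ->
  0 < T -> curve_param U eps f L A B ->
  GRH_surface eps f T L A B x y ap bp am bm ->
  same_surface U eps f (shock_set T L x y) (variational_set U eps f) ->
  L l ->
  exists delta, 0 < delta /\ delta <= T /\
    forall t m, 0 < t < delta -> Rabs (m - l) < delta ->
      L m /\
      bp t m + eps * f (ap t m) (bp t m)
      + t / 2 * (gu (ap t m) (bp t m) ^ 2 + gv (ap t m) (bp t m) ^ 2) = 0.
Proof.
intros Hf Hu Hv Eu Ev HUo HUb HT (HLo & HLU & _) HG HS Hl.
assert (HG' := HG).
destruct HG' as (HC1 & Hini & Hrp & _).
destruct (proj2 (HLU (A l) (B l)) (ex_intro _ l (conj Hl (conj eq_refl eq_refl))))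
  as [HUl Hcurve].
destruct (HS (A l) (B l) HUl Hcurve) as [d0 [Hd0 Hsame]].
assert (HK : 0 <= K).
{ destruct (HUb _ _ HUl) as [HK _]; assert (P := Rabs_pos (A l)); lra. }
destruct (C1_partials_lipschitz gu gux guy K HK Hu) as [M1 [HM1 Lip1]].
destruct (C1_partials_lipschitz gv gvx gvy K HK Hv) as [M2 [HM2 Lip2]].
set (M := M1 + M2).
destruct (Hini l Hl) as [Ex0 Ey0].
destruct (Hrp 0 l ltac:(lra) Hl) as [Ea0 Eb0].
rewrite Rmult_0_l, Rplus_0_r in Ea0, Eb0.
destruct (HUo _ HUl) as [e He].
destruct (HLo _ Hl) as [d1 HL1].
destruct (C1_to_zero_near T L x l d0 HT Hl) as [dx [Hdx Nx]];
  [apply HC1; tauto|exact Hd0|].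
destruct (C1_to_zero_near T L y l d0 HT Hl) as [dy [Hdy Ny]];
  [apply HC1; tauto|exact Hd0|].
destruct (C1_to_zero_near T L ap l e HT Hl) as [da [Hda Na]];
  [apply HC1; tauto|apply cond_pos|].
destruct (C1_to_zero_near T L bp l e HT Hl) as [db [Hdb Nb]];
  [apply HC1; tauto|apply cond_pos|].
assert (HM : 0 < M) by (unfold M; lra).
(* Below this time [t * (4 * M) < 1], the condition of [flow_injective]. *)
set (dm := / (4 * M)).
assert (Hdm : 0 < dm) by (apply Rinv_0_lt_compat; lra).
assert (Hd1 := cond_pos d1).
assert (Hmin : exists delta, 0 < delta /\ delta <= T /\ delta <= d0
  /\ delta <= d1 /\ delta <= dx /\ delta <= dy /\ delta <= da /\ delta <= db
  /\ delta <= dm).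
{ exists (Rmin T (Rmin d0 (Rmin d1 (Rmin dx (Rmin dy (Rmin da (Rmin db dm))))))).
  split; [repeat apply Rmin_pos; assumption|].
  repeat (split; [first [apply Rmin_l|
    repeat (eapply Rle_trans; [apply Rmin_r|]; try apply Rmin_l; try lra)]|]).
  all: repeat first [apply Rle_refl | eapply Rle_trans; [apply Rmin_r|]]. }
destruct Hmin as (delta & H0 & HdT & H1 & H2 & H3 & H4 & H5 & H6 & H7).
exists delta; split; [exact H0|split; [exact HdT|]].
intros t m Ht Hm.
assert (HLm : L m) by (apply HL1; change (Rabs (m - l) < d1); lra).
split; [exact HLm|].
destruct (plus_foot_flow eps f fa fb T L A B x y ap bp am bm Hf HG t m
            ltac:(lra) HLm) as (_ & _ & Ex & Ey).
assert (HF : variational_set U eps f t (x t m) (y t m)).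
{ apply Hsame; [lra| | |].
  - rewrite <- Ex0; apply Nx; lra.
  - rewrite <- Ey0; apply Ny; lra.
  - split; [lra|exists m; auto]. }
destruct (variational_set_eikonal U eps f fa fb _ _ _ Hf HF)
  as (a & b & HUab & Exa & Eyb & E).
(* The plus foot starts at the curve point [(A l, B l)] of the open set [U] and stays close to it,
   so the bound [K] applies to it too. *)
assert (HUq : U (ap t m, bp t m)).
{ apply He; split; simpl.
  - change (Rabs (ap t m - A l) < e); rewrite <- Ex0, Ea0; apply Na; lra.
  - change (Rabs (bp t m - B l) < e); rewrite <- Ey0, Eb0; apply Nb; lra. }
destruct (HUb _ _ HUab) as [Ka Kb]; destruct (HUb _ _ HUq) as [Kp Kq].
assert (HtM : t * (4 * M) < 1).
{ apply (Rlt_le_trans _ (dm * (4 * M))); [apply Rmult_lt_compat_r; lra|].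
  unfold dm; rewrite Rinv_l; lra. }
assert (Hab : ap t m = a /\ bp t m = b).
{ apply (flow_injective gu gv M t); [exact HM|lra|exact HtM| | | |].
  - eapply Rle_trans; [apply Lip1; assumption|].
    apply Rmult_le_compat_r; [|unfold M; lra].
    assert (P := Rabs_pos (ap t m - a)); assert (P' := Rabs_pos (bp t m - b)).
    lra.
  - eapply Rle_trans; [apply Lip2; assumption|].
    apply Rmult_le_compat_r; [|unfold M; lra].
    assert (P := Rabs_pos (ap t m - a)); assert (P' := Rabs_pos (bp t m - b)).
    lra.
  - rewrite !Eu; lra.
  - rewrite !Ev; lra. }
destruct Hab as [-> ->]; rewrite Eu, Ev; exact E.
Qed.

(** The conclusion says that the level curve of [b + eps * f a b] through the point has zero
    curvature there. The proof supplies [curvature_from_momentum_balance] with its data, the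
    derivatives of the minus foot playing the part of those of the shock point. *)
Lemma same_surface_flat (eps K T : R) (U : R * R -> Prop)
  (f fa fb gu gux guy gv gvx gvy : R -> R -> R) (L : R -> Prop) (A B : R -> R)
  (x y ap bp am bm : R -> R -> R) (l : R) :
  C1_partials f fa fb -> C1_partials gu gux guy -> C1_partials gv gvx gvy ->
  (forall a b, gu a b = eps * fa a b) ->
  (forall a b, gv a b = 1 + eps * fb a b) ->
  open U -> (forall a b, U (a, b) -> Rabs a <= K /\ Rabs b <= K) ->
  0 < T -> curve_param U eps f L A B ->
  GRH_surface eps f T L A B x y ap bp am bm ->
  same_surface U eps f (shock_set T L x y) (variational_set U eps f) ->
  L l -> gv (A l) (B l) <> 0 ->
  gv (A l) (B l) ^ 2 * gux (A l) (B l)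
  - gu (A l) (B l) * gv (A l) (B l) * (guy (A l) (B l) + gvx (A l) (B l))
  + gu (A l) (B l) ^ 2 * gvy (A l) (B l) = 0.
Proof.
intros Hf Hu Hv Eu Ev HUo HUb HT HcL HG HS Hl Hgv.
destruct (same_surface_eikonal eps K T U f fa fb gu gux guy gv gvx gvy L A B
            x y ap bp am bm l Hf Hu Hv Eu Ev HUo HUb HT HcL HG HS Hl)
  as (delta & Hdelta & HdT & HE).
assert (Hfoot := minus_foot_is_shock eps f fa fb T L A B x y ap bp am bm Hf HG).
assert (Hflow := plus_foot_flow eps f fa fb T L A B x y ap bp am bm Hf HG).
destruct HcL as (HLo & _ & _ & HA).
destruct HG as (HC1 & Hini & Hrp & _ & HR).
destruct (HC1 ap ltac:(tauto)) as (apt & apl & Hap).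
destruct (HC1 bp ltac:(tauto)) as (bpt & bpl & Hbp).
destruct (HC1 am ltac:(tauto)) as (amt & aml & Ham).
destruct (HC1 bm ltac:(tauto)) as (bmt & bml & Hbm).
set (ext := fun (h : R -> R -> R) (s : R) => h (Rmax 0 s) l).
assert (Hext : forall (h : R -> R -> R) s, 0 <= s -> ext h s = h s l).
{ intros h s Hs; unfold ext; rewrite Rmax_right by exact Hs; reflexivity. }
assert (Cext : forall g gt gl h : R -> R -> R,
  (forall t m, 0 <= t < T -> L m ->
      (0 < t -> is_derive (fun s => g s m) t (gt t m))
      /\ is_derive (fun m => g t m) m (gl t m)
      /\ (forall h : R -> R -> R, h = g \/ h = gt \/ h = gl ->
            filterlim (fun z : R * R => h (fst z) (snd z))
              (within (fun z : R * R => 0 <= fst z) (locally (t, m)))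
              (locally (h t m)))) ->
  h = g \/ h = gt \/ h = gl -> forall s, s < T -> continuous (ext h) s).
{ intros g gt gl h Hg Hh; apply continuous_extend_before_zero; [exact HT|].
  intros t Ht; apply (Hg t l Ht Hl); exact Hh. }
assert (Cap : forall s, s < T -> continuous (ext ap) s)
  by (apply (Cext ap apt apl); auto).
assert (Cbp : forall s, s < T -> continuous (ext bp) s)
  by (apply (Cext bp bpt bpl); auto).
assert (Ea0 : ext ap 0 = A l).
{ rewrite Hext by lra; destruct (Hini l Hl) as [<- _].
  destruct (Hrp 0 l ltac:(lra) Hl) as [-> _]; ring. }
assert (Eb0 : ext bp 0 = B l).
{ rewrite Hext by lra; destruct (Hini l Hl) as [_ <-].
  destruct (Hrp 0 l ltac:(lra) Hl) as [_ ->]; ring. }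
assert (HLl : locally l L) by exact (HLo _ Hl).
assert (Hnear_t : forall s, 0 < s < T -> locally s (fun r => 0 < r < T)).
{ intros s Hs; apply (locally_interval _ s 0 T); simpl; [lra|lra|auto]. }
assert (Hnear_E : forall s, 0 < s < delta ->
          locally s (fun r => 0 < r < delta)
          /\ locally l (fun m => Rabs (m - l) < delta)).
{ intros s Hs; split.
  - apply (locally_interval _ s 0 delta); simpl; [lra|lra|auto].
  - exists (mkposreal _ Hdelta); intros m Hm; exact Hm. }
set (u := fun s => gu (ext ap s) (ext bp s)).
set (v := fun s => gv (ext ap s) (ext bp s)).
rewrite <- Ea0, <- Eb0 in Hgv |- *.
apply (curvature_from_momentum_balance delta u v
  (fun s => gux (ext ap s) (ext bp s)) (fun s => guy (ext ap s) (ext bp s))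
  (fun s => gvx (ext ap s) (ext bp s)) (fun s => gvy (ext ap s) (ext bp s))
  (ext apt) (ext bpt) (ext apl) (ext bpl)
  (ext amt) (ext bmt) (ext aml) (ext bml)); [exact Hdelta| | | |].
- intros g Hg s Hs.
  assert (Ca := Cap s ltac:(lra)); assert (Cb := Cbp s ltac:(lra)).
  repeat destruct Hg as [<-|Hg]; try contradiction;
    first
    [ apply (continuous_C1_partials_comp _ gu gux guy); simpl; tauto
    | apply (continuous_C1_partials_comp _ gv gvx gvy); simpl; tauto
    | apply (Cext ap apt apl); auto; lra
    | apply (Cext bp bpt bpl); auto; lra
    | apply (Cext am amt aml); auto; lra
    | apply (Cext bm bmt bml); auto; lra ].
- intros s Hs.
  assert (HsT : 0 < s < T) by lra.
  assert (Hext_loc : forall h : R -> R -> R,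
            locally s (fun r => h r l = ext h r)).
  { intros h; generalize (Hnear_t s HsT); apply filter_imp.
    intros r Hr; symmetry; apply Hext; lra. }
  assert (Dap : is_derive (ext ap) s (ext apt s)).
  { apply (is_derive_ext_loc (fun r => ap r l)); [apply Hext_loc|].
    rewrite Hext by lra; apply Hap; [lra|exact Hl|lra]. }
  assert (Dbp : is_derive (ext bp) s (ext bpt s)).
  { apply (is_derive_ext_loc (fun r => bp r l)); [apply Hext_loc|].
    rewrite Hext by lra; apply Hbp; [lra|exact Hl|lra]. }
  assert (Dam : is_derive (ext am) s (ext amt s)).
  { apply (is_derive_ext_loc (fun r => am r l)); [apply Hext_loc|].
    rewrite Hext by lra; apply Ham; [lra|exact Hl|lra]. }
  assert (Dbm : is_derive (ext bm) s (ext bmt s)).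
  { apply (is_derive_ext_loc (fun r => bm r l)); [apply Hext_loc|].
    rewrite Hext by lra; apply Hbm; [lra|exact Hl|lra]. }
  assert (Du := C1_partials_chain gu gux guy _ _ s _ _ Hu Dap Dbp).
  assert (Dv := C1_partials_chain gv gvx gvy _ _ s _ _ Hv Dap Dbp).
  assert (Df := C1_partials_chain f fa fb _ _ s _ _ Hf Dap Dbp).
  assert (Lap := proj1 (proj2 (Hap s l ltac:(lra) Hl))).
  assert (Lbp := proj1 (proj2 (Hbp s l ltac:(lra) Hl))).
  assert (Lam := proj1 (proj2 (Ham s l ltac:(lra) Hl))).
  assert (Lbm := proj1 (proj2 (Hbm s l ltac:(lra) Hl))).
  assert (Lu := C1_partials_chain gu gux guy _ _ l _ _ Hu Lap Lbp).
  assert (Lv := C1_partials_chain gv gvx gvy _ _ l _ _ Hv Lap Lbp).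
  assert (Lf := C1_partials_chain f fa fb _ _ l _ _ Hf Lap Lbp).
  cbv beta in Du, Dv, Df, Lu, Lv, Lf.
  assert (Huniq : forall (g : R -> R) z d d',
            is_derive g z d -> is_derive g z d' -> d = d').
  { intros g z d d' H1 H2.
    rewrite <- (is_derive_unique g z d H1); exact (is_derive_unique g z d' H2). }
  (* Differentiating this relation in time and in [l] yields the four formulas for the derivatives
     of the shock point. *)
  assert (Hchar : forall r m, 0 < r < T -> L m ->
            am r m = ap r m + r * gu (ap r m) (bp r m)
            /\ bm r m = bp r m + r * gv (ap r m) (bp r m)).
  { intros r m Hr Hm.
    destruct (Hfoot r m ltac:(lra) Hm) as [<- <-].
    destruct (Hflow r m Hr Hm) as (_ & _ & Ex & Ey).
    rewrite Eu, Ev; auto. }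
  assert (Dtu : is_derive (fun r => r * u r) s
    (1 * u s + s * (gux (ext ap s) (ext bp s) * ext apt s
                    + guy (ext ap s) (ext bp s) * ext bpt s))).
  { apply (is_derive_mult (fun r => r) u s 1 _ (is_derive_id s) Du).
    exact Rmult_comm. }
  assert (Dtv : is_derive (fun r => r * v r) s
    (1 * v s + s * (gvx (ext ap s) (ext bp s) * ext apt s
                    + gvy (ext ap s) (ext bp s) * ext bpt s))).
  { apply (is_derive_mult (fun r => r) v s 1 _ (is_derive_id s) Dv).
    exact Rmult_comm. }
  assert (EXt : ext amt s = ext apt s + u s
    + s * (gux (ext ap s) (ext bp s) * ext apt s
           + guy (ext ap s) (ext bp s) * ext bpt s)).
  { apply (Huniq (ext am) s); [exact Dam|].
    replace (_ + _) with (ext apt s + (1 * u s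
      + s * (gux (ext ap s) (ext bp s) * ext apt s
             + guy (ext ap s) (ext bp s) * ext bpt s))) by ring.
    apply (is_derive_ext_loc (fun r => ext ap r + r * u r)).
    - generalize (Hnear_t s HsT); apply filter_imp; intros r Hr.
      unfold u; rewrite !Hext by lra; symmetry; apply Hchar; assumption.
    - apply (is_derive_plus (V := R_NormedModule)); assumption. }
  assert (EYt : ext bmt s = ext bpt s + v s
    + s * (gvx (ext ap s) (ext bp s) * ext apt s
           + gvy (ext ap s) (ext bp s) * ext bpt s)).
  { apply (Huniq (ext bm) s); [exact Dbm|].
    replace (_ + _) with (ext bpt s + (1 * v s
      + s * (gvx (ext ap s) (ext bp s) * ext apt s
             + gvy (ext ap s) (ext bp s) * ext bpt s))) by ring.
    apply (is_derive_ext_loc (fun r => ext bp r + r * v r)).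
    - generalize (Hnear_t s HsT); apply filter_imp; intros r Hr.
      unfold v; rewrite !Hext by lra; symmetry; apply Hchar; assumption.
    - apply (is_derive_plus (V := R_NormedModule)); assumption. }
  assert (EXl : ext aml s = ext apl s
    + s * (gux (ext ap s) (ext bp s) * ext apl s
           + guy (ext ap s) (ext bp s) * ext bpl s)).
  { rewrite !Hext by lra.
    apply (Huniq (fun m => am s m) l); [exact Lam|].
    apply (is_derive_ext_loc (fun m => ap s m + s * gu (ap s m) (bp s m))).
    - generalize HLl; apply filter_imp; intros m Hm.
      symmetry; apply Hchar; assumption.
    - apply (is_derive_plus (V := R_NormedModule)); [exact Lap|].
      apply (is_derive_scal (fun m => gu (ap s m) (bp s m))); exact Lu. }
  assert (EYl : ext bml s = ext bpl s
    + s * (gvx (ext ap s) (ext bp s) * ext apl s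
           + gvy (ext ap s) (ext bp s) * ext bpl s)).
  { rewrite !Hext by lra.
    apply (Huniq (fun m => bm s m) l); [exact Lbm|].
    apply (is_derive_ext_loc (fun m => bp s m + s * gv (ap s m) (bp s m))).
    - generalize HLl; apply filter_imp; intros m Hm.
      symmetry; apply Hchar; assumption.
    - apply (is_derive_plus (V := R_NormedModule)); [exact Lbp|].
      apply (is_derive_scal (fun m => gv (ap s m) (bp s m))); exact Lv. }
  assert (Hsquare : forall (g : R -> R) z d, is_derive g z d ->
            is_derive (fun r => g r * g r) z (d * g z + g z * d)).
  { intros g z d Hg; apply (is_derive_mult g g z d d Hg Hg); exact Rmult_comm. }
  (* The time derivative of the eikonal relation is N . p_t + |N|^2 / 2 + s N . N' = 0, with p the
     plus foot, because [N] is the gradient of [b + eps * f a b]. Substituting X_t = p_t + N + s N'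
     gives the claim. *)
  assert (ENt : u s * ext amt s + v s * ext bmt s = (u s ^ 2 + v s ^ 2) / 2).
  { assert (D0 : is_derive (fun r => ext bp r + eps * f (ext ap r) (ext bp r)
                    + / 2 * ((r * u r) * u r + (r * v r) * v r)) s 0).
    { apply (is_derive_ext_loc (fun _ => 0)); [|apply (is_derive_const 0)].
      generalize (proj1 (Hnear_E s Hs)); apply filter_imp; intros r Hr.
      destruct (HE r l Hr) as [_ E].
      { unfold Rminus; rewrite Rplus_opp_r, Rabs_R0; exact Hdelta. }
      rewrite <- E; unfold u, v; rewrite !Hext by lra; equation_in_R; field. }
    assert (D1 := is_derive_plus (V := R_NormedModule) _ _ _ _ _
      (is_derive_plus (V := R_NormedModule) _ _ _ _ _ Dbp
         (is_derive_scal _ _ eps _ Df))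
      (is_derive_scal _ _ (/ 2) _
        (is_derive_plus (V := R_NormedModule) _ _ _ _ _
          (is_derive_mult _ _ _ _ _ Dtu Du Rmult_comm)
          (is_derive_mult _ _ _ _ _ Dtv Dv Rmult_comm)))).
    assert (E := Huniq _ _ _ _ D0 D1).
    unfold plus, mult in E; simpl in E; unfold plus, mult in E; simpl in E.
    assert (E1 := Eu (ext ap s) (ext bp s)).
    assert (E2 := Ev (ext ap s) (ext bp s)).
    change (gu (ext ap s) (ext bp s)) with (u s) in *.
    change (gv (ext ap s) (ext bp s)) with (v s) in *.
    rewrite EXt, EYt.
    replace (ext bpt s + eps * (fa (ext ap s) (ext bp s) * ext apt s
               + fb (ext ap s) (ext bp s) * ext bpt s))
      with (u s * ext apt s + v s * ext bpt s) in E
      by (rewrite E1, E2; ring).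
    lra. }
  (* The derivative in [l] is N . (p_l + s N_l) = 0, and the bracket is [X_l]. *)
  assert (ENl : u s * ext aml s + v s * ext bml s = 0).
  { set (W := fun m => gu (ap s m) (bp s m) * gu (ap s m) (bp s m)
                       + gv (ap s m) (bp s m) * gv (ap s m) (bp s m)).
    assert (D0 : is_derive (fun m => bp s m + eps * f (ap s m) (bp s m)
                    + s / 2 * W m) l 0).
    { apply (is_derive_ext_loc (fun _ => 0)); [|apply (is_derive_const 0)].
      generalize (proj2 (Hnear_E s Hs)); apply filter_imp; intros m Hm.
      destruct (HE s m Hs Hm) as [_ E].
      rewrite <- E; unfold W; equation_in_R; ring. }
    assert (D1 := is_derive_plus (V := R_NormedModule) _ _ _ _ _
      (is_derive_plus (V := R_NormedModule) _ _ _ _ _ Lbp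
         (is_derive_scal _ _ eps _ Lf))
      (is_derive_scal _ _ (s / 2) _
        (is_derive_plus (V := R_NormedModule) _ _ _ _ _
          (Hsquare _ _ _ Lu) (Hsquare _ _ _ Lv)))).
    assert (E := Huniq _ _ _ _ D0 D1).
    unfold plus, mult in E; simpl in E.
    assert (E1 := Eu (ap s l) (bp s l)).
    assert (E2 := Ev (ap s l) (bp s l)).
    rewrite EXl, EYl; unfold u, v; rewrite !Hext by lra.
    replace (bpl s l + eps * (fa (ap s l) (bp s l) * apl s l
               + fb (ap s l) (bp s l) * bpl s l))
      with (gu (ap s l) (bp s l) * apl s l + gv (ap s l) (bp s l) * bpl s l) in E
      by (rewrite E1, E2; ring).
    lra. }
  destruct (HR s l HsT Hl) as (_ & _ & HP & Dx & Dy).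
  set (mp := fun r => ext apt r * ext bpl r - ext bpt r * ext apl r).
  set (mm := fun r => ext amt r * ext bml r - ext bmt r * ext aml r).
  (* Integrands are compared on the open interval only, which determines the integrals and avoids
     the two-sided [Derive] at time 0. *)
  assert (HM : forall r, 0 < r < s ->
            Mjac ap bp r l = mp r /\ Mjac am bm r l = mm r).
  { intros r Hr.
    assert (HDt : forall g gt gl, (forall t m, 0 <= t < T -> L m ->
      (0 < t -> is_derive (fun s => g s m) t (gt t m))
      /\ is_derive (fun m => g t m) m (gl t m)
      /\ (forall h : R -> R -> R, h = g \/ h = gt \/ h = gl ->
            filterlim (fun z : R * R => h (fst z) (snd z))
              (within (fun z : R * R => 0 <= fst z) (locally (t, m)))
              (locally (h t m)))) ->
      Derive (fun s => g s l) r = ext gt r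
      /\ Derive (fun m => g r m) l = ext gl r).
    { intros g gt gl Hg; rewrite !Hext by lra.
      destruct (Hg r l ltac:(lra) Hl) as (H1 & H2 & _).
      split; apply is_derive_unique; [apply H1; lra|exact H2]. }
    unfold Mjac.
    destruct (HDt ap apt apl Hap) as [-> ->].
    destruct (HDt bp bpt bpl Hbp) as [-> ->].
    destruct (HDt am amt aml Ham) as [-> ->].
    destruct (HDt bm bmt bml Hbm) as [-> ->].
    split; reflexivity. }
  (* With zero velocity the minus side drops out of the momenta, though not out of the mass. *)
  assert (Hminus : forall r, 0 < r < s ->
            u0 eps f (am r l) (bm r l) = 0 /\ v0 eps f (am r l) (bm r l) = 0).
  { intros r Hr.
    destruct (HR r l ltac:(lra) Hl) as (_ & Hm & _).
    destruct (S0_derive_minus eps f fa fb _ _ Hf Hm) as [H1 H2].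
    split; apply is_derive_unique; assumption. }
  assert (EP : Pmass ap bp am bm s l = RInt (fun r => mp r - mm r) 0 s).
  { apply RInt_ext; intros r; rewrite Rmin_left, Rmax_right by lra; intros Hr.
    destruct (HM r Hr) as [-> ->]; simpl; ring. }
  assert (EI : Imom eps f ap bp am bm s l = RInt (fun r => u r * mp r) 0 s).
  { apply RInt_ext; intros r; rewrite Rmin_left, Rmax_right by lra; intros Hr.
    destruct (HM r Hr) as [-> ->]; destruct (Hminus r Hr) as [-> _].
    destruct (Hflow r l ltac:(lra) Hl) as (-> & _).
    unfold u; rewrite !Hext by lra; rewrite Eu; simpl; ring. }
  assert (EJ : Jmom eps f ap bp am bm s l = RInt (fun r => v r * mp r) 0 s).
  { apply RInt_ext; intros r; rewrite Rmin_left, Rmax_right by lra; intros Hr.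
    destruct (HM r Hr) as [-> ->]; destruct (Hminus r Hr) as [_ ->].
    destruct (Hflow r l ltac:(lra) Hl) as (_ & -> & _).
    unfold v; rewrite !Hext by lra; rewrite Ev; simpl; ring. }
  assert (EX : ext amt s = Imom eps f ap bp am bm s l / Pmass ap bp am bm s l).
  { apply (Huniq (ext am) s); [exact Dam|].
    apply (is_derive_ext_loc (fun r => x r l)); [|exact Dx].
    generalize (Hnear_t s HsT); apply filter_imp; intros r Hr.
    rewrite Hext by lra; apply Hfoot; [lra|exact Hl]. }
  assert (EY : ext bmt s = Jmom eps f ap bp am bm s l / Pmass ap bp am bm s l).
  { apply (Huniq (ext bm) s); [exact Dbm|].
    apply (is_derive_ext_loc (fun r => y r l)); [|exact Dy].
    generalize (Hnear_t s HsT); apply filter_imp; intros r Hr.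
    rewrite Hext by lra; apply Hfoot; [lra|exact Hl]. }
  assert (IX : ext amt s * RInt (fun r => mp r - mm r) 0 s
               = RInt (fun r => u r * mp r) 0 s).
  { rewrite <- EP, <- EI, EX; field; exact HP. }
  assert (IY : ext bmt s * RInt (fun r => mp r - mm r) 0 s
               = RInt (fun r => v r * mp r) 0 s).
  { rewrite <- EP, <- EJ, EY; field; exact HP. }
  split; [exact Du|]; split; [exact Dv|].
  repeat (split; [assumption|]); assumption.
- change (v 0 <> 0) in Hgv; intro E.
  apply Hgv; nra.
(* At time 0 the minus foot traces the initial curve, so [Xl 0] is the derivative of [A], which is
   positive. *)
- destruct (HA l Hl) as (_ & _ & HAl).
  rewrite Hext by lra.
  enough (E : Derive A l = aml 0 l) by lra.
  apply is_derive_unique.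
  apply (is_derive_ext_loc (fun m => am 0 m)); [|apply Ham; [lra|exact Hl]].
  generalize HLl; apply filter_imp; intros m Hm.
  destruct (Hfoot 0 m ltac:(lra) Hm) as [<- _]; apply Hini, Hm.
Qed.

(** * A curve point of nonzero curvature for small [eps] *)

(** Once [eps * m < r], the function [b + eps * f a b] changes sign between [- r] and [r], and the
    intermediate value theorem gives a zero. *)
Lemma curve_point_near (f : R -> R -> R) (a r : R) :
  0 < r -> continuity (fun b => f a b) ->
  exists e, 0 < e /\ forall eps, 0 < eps < e ->
    exists b, Rabs b <= r /\ on_curve eps f a b.
Proof.
intros Hr Hf.
set (m := Rabs (f a r) + Rabs (f a (- r)) + 1).
assert (P1 := Rabs_pos (f a r)); assert (P2 := Rabs_pos (f a (- r))).
exists (r / m); split; [apply Rdiv_lt_0_compat; unfold m; lra|].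
intros eps He.
assert (Hem : eps * m < r).
{ replace r with (r / m * m) by (field; unfold m; lra).
  apply Rmult_lt_compat_r; unfold m in *; lra. }
assert (B1 := proj1 (Rabs_le_between _ _) (Rle_refl (Rabs (f a r)))).
assert (B2 := proj1 (Rabs_le_between _ _) (Rle_refl (Rabs (f a (- r))))).
assert (Hc : continuity (fun b => b + eps * f a b)).
{ apply (continuity_plus (fun b => b) (fun b => eps * f a b)).
  - exact (derivable_continuous _ derivable_id).
  - apply (continuity_scal (fun b => f a b) eps Hf). }
assert (V1 : - r + eps * f a (- r) <= 0) by (unfold m in Hem; nra).
assert (V2 : 0 <= r + eps * f a r) by (unfold m in Hem; nra).
destruct (IVT_gen _ (- r) r 0 Hc) as [b [Hb Eb]].
{ rewrite Rmin_left, Rmax_right by lra; lra. }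
rewrite Rmin_left, Rmax_right in Hb by lra.
exists b; split; [apply Rabs_le; lra|exact Eb].
Qed.

(** The second expression is the curvature expression of [same_surface_flat] divided by [eps]. It is
    jointly continuous in [(eps, b)] and equals [faa a 0] at [(0, 0)]. *)
Lemma curvature_nonzero_near (fa fb faa fab fba fbb : R -> R -> R) (a : R) :
  C1_partials fa faa fab -> C1_partials fb fba fbb -> faa a 0 <> 0 ->
  exists d, 0 < d /\ forall eps b, Rabs eps < d -> Rabs b < d ->
    1 + eps * fb a b <> 0 /\
    (1 + eps * fb a b) ^ 2 * faa a b
    - eps * fa a b * (1 + eps * fb a b) * (fab a b + fba a b)
    + (eps * fa a b) ^ 2 * fbb a b <> 0.
Proof.
intros Ha Hb H0.
set (g := fun z : R * R => 1 + fst z * fb a (snd z)).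
set (H := fun z : R * R => g z * g z * faa a (snd z)
  - fst z * fa a (snd z) * g z * (fab a (snd z) + fba a (snd z))
  + fst z * fa a (snd z) * (fst z * fa a (snd z)) * fbb a (snd z)).
assert (Hpart : forall h, In h [fa; faa; fab] \/ In h [fb; fba; fbb] ->
          continuous (fun z : R * R => h a (snd z)) (0, 0)).
{ intros h [Hh|Hh].
  - apply (continuous_C1_partials_comp _ fa faa fab h (fun _ => a) snd);
      [exact Ha|exact Hh|apply continuous_const|apply continuous_snd].
  - apply (continuous_C1_partials_comp _ fb fba fbb h (fun _ => a) snd);
      [exact Hb|exact Hh|apply continuous_const|apply continuous_snd]. }
assert (C0 : continuous (fun z : R * R => fst z) (0, 0))
  by apply continuous_fst.
assert (Cg : continuous g (0, 0)).
{ unfold g; continuity_arith; first [exact C0|apply Hpart; simpl; tauto]. }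
assert (CH : continuous H (0, 0)).
{ unfold H; continuity_arith;
    first [exact C0|exact Cg|apply Hpart; simpl; tauto]. }
assert (L1 : locally (0, 0) (fun z : R * R => g z <> 0)).
{ apply (Cg (fun w => w <> 0)), open_neq; unfold g; simpl; lra. }
assert (L2 : locally (0, 0) (fun z : R * R => H z <> 0)).
{ apply (CH (fun w => w <> 0)), open_neq; unfold H, g; simpl.
  replace (_ + _) with (faa a 0) by ring; exact H0. }
destruct (filter_and _ _ L1 L2) as [d Hd].
exists d; split; [apply cond_pos|].
intros eps b He Hb'.
destruct (Hd (eps, b)) as [D1 D2].
{ split; [change (Rabs (eps - 0) < d)|change (Rabs (b - 0) < d)];
    rewrite Rminus_0_r; assumption. }
split; [exact D1|].
intro E; apply D2; unfold H, g; simpl; rewrite <- E; ring.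
Qed.

Theorem theorem3p1
  (f : R -> R -> R) (hf : smooth2 f) (hf0 : f 0 0 = 0)
  (U : R * R -> Prop) (hUopen : open U) (hU0 : U (0, 0))
  (hUbdd : exists K : R, forall a b : R, U (a, b) -> Rabs a <= K /\ Rabs b <= K)
  (hfaa : exists a : R, U (a, 0) /\ Derive_n (fun a' => f a' 0) 2 a <> 0)
  (hmono : exists eps1 : R, 0 < eps1 /\
     forall eps : R, 0 < eps < eps1 -> monotone_curve_in U eps f) :
  exists eps0 : R, 0 < eps0 /\
    forall eps : R, 0 < eps < eps0 ->
    forall (T : R) (L : R -> Prop) (A B : R -> R)
           (x y ap bp am bm : R -> R -> R),
      0 < T ->
      curve_param U eps f L A B ->
      GRH_surface eps f T L A B x y ap bp am bm ->
      ~ same_surface U eps f (shock_set T L x y) (variational_set U eps f).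
Proof.
destruct hUbdd as [K hK], hfaa as [a [hUa ha]].
set (fa := fun a b => Derive (fun z => f z b) a).
set (fb := fun a b => Derive (fun z => f a z) b).
destruct (smooth2_partials f hf) as (Hf & Sa & Sb).
destruct (smooth2_partials _ Sa) as (Ha & _ & _).
destruct (smooth2_partials _ Sb) as (Hb & _ & _).
fold fa fb in Hf, Ha, Hb.
set (faa := fun a b => Derive (fun z => fa z b) a) in Ha.
set (fab := fun a b => Derive (fun z => fa a z) b) in Ha.
set (fba := fun a b => Derive (fun z => fb z b) a) in Hb.
set (fbb := fun a b => Derive (fun z => fb a z) b) in Hb.
destruct (curvature_nonzero_near fa fb faa fab fba fbb a Ha Hb ha)
  as [d [Hd HQ]].
destruct (hUopen _ hUa) as [e He].
assert (He0 := cond_pos e).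
(* Within height [r] of [(a, 0)] the curve point is in [U] and the curvature does not vanish. *)
set (r := Rmin d e / 2).
assert (Hr : 0 < r /\ r < d /\ r < e).
{ assert (0 < Rmin d e) by (apply Rmin_pos; assumption).
  assert (Rmin d e <= d) by apply Rmin_l.
  assert (Rmin d e <= e) by apply Rmin_r.
  unfold r; lra. }
destruct (curve_point_near f a r) as [e0 [He0' Hcurve]]; [lra| |].
{ intros z; apply continuity_pt_filterlim.
  apply (ex_derive_continuous (fun b => f a b)).
  exists (fb a z); apply Hf. }
exists (Rmin d e0); split; [apply Rmin_pos; assumption|].
intros eps Heps T L A B x y ap bp am bm HT HcL HG HS.
assert (Hed : eps < d) by (eapply Rlt_le_trans; [apply Heps|apply Rmin_l]).
assert (Hee : eps < e0) by (eapply Rlt_le_trans; [apply Heps|apply Rmin_r]).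
destruct (Hcurve eps ltac:(lra)) as [b [Hbr Hb0]].
assert (HUb : U (a, b)).
{ apply He; split; [apply ball_center|].
  change (Rabs (b - 0) < e); rewrite Rminus_0_r; lra. }
destruct (proj1 (proj1 (proj2 HcL) a b) (conj HUb Hb0)) as [l [Hl [<- <-]]].
destruct (HQ eps (B l)) as [HQ1 HQ2];
  [rewrite Rabs_pos_eq; lra|lra|].
(* The vanishing curvature expression is [eps] times the quantity shown to be nonzero. *)
apply HQ2.
apply (Rmult_eq_reg_l eps); [|lra].
rewrite Rmult_0_r.
assert (Hu := C1_partials_affine fa faa fab 0 0 eps Ha).
assert (Hv := C1_partials_affine fb fba fbb 1 0 eps Hb).
assert (E : forall gu gux guy gv gvx gvy : R -> R -> R,
  C1_partials gu gux guy -> C1_partials gv gvx gvy ->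
  (forall a b, gu a b = eps * fa a b) ->
  (forall a b, gv a b = 1 + eps * fb a b) ->
  gv (A l) (B l) ^ 2 * gux (A l) (B l)
  - gu (A l) (B l) * gv (A l) (B l) * (guy (A l) (B l) + gvx (A l) (B l))
  + gu (A l) (B l) ^ 2 * gvy (A l) (B l) = 0).
{ intros gu gux guy gv gvx gvy Hgu Hgv Eu Ev.
  apply (same_surface_flat eps K T U f fa fb gu gux guy gv gvx gvy L A B
           x y ap bp am bm l); try assumption.
  rewrite Ev; exact HQ1. }
specialize (E _ _ _ _ _ _ Hu Hv ltac:(intros; cbv beta; ring)
              ltac:(intros; cbv beta; ring)).
cbv beta in E; rewrite <- E; ring.
Qed.
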